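(* Let $r\ge 4$. If $p=p(n) > n^{-2/(r+2)}$, then with high probability as $n\to\infty$, \[T_r(n,p) \le \exp\bigg(\frac{O\big(n(\log n)^2\big)}{p}\bigg).\]
   Context: $G(n,p)$ is the Erdős–Rényi random graph on $n$ vertices with edge probability $p$. $T_r(n,p)$ is the number of orientations of $G(n,p)$ in which every copy of $K_r$ is transitively oriented. The $O(\cdot)$ hides a constant depending only on $r$. *)

(* Defs.v *)
From mathcomp Require Import all_boot all_order all_algebra.
From mathcomp Require Import all_classical all_reals all_analysis.

Set Implicit Arguments.
Unset Strict Implicit.
Unset Printing Implicit Defensive.

Import Order.TTheory GRing.Theory Num.Theory.
Import numFieldNormedType.Exports.

Local Open Scope ring_scope.

Notation vpair n := {e : {set 'I_n} | #|e| == 2%N}.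

(* A simple graph on the vertex set 'I_n is its edge set G : {set vpair n}. *)
Definition adj n (G : {set vpair n}) : rel 'I_n :=
  fun u v => [exists e in G, val e == [set u; v]].

(* (u, v) \in D stands for the arc u -> v. *)
Definition orientation n (G : {set vpair n}) (D : {set 'I_n * 'I_n}) : bool :=
  [forall u, forall v,
     ((((u, v) \in D) || ((v, u) \in D)) == adj G u v)
       && ~~ (((u, v) \in D) && ((v, u) \in D))].

Definition clique n (G : {set vpair n}) (S : {set 'I_n}) : bool :=
  [forall u in S, forall v in S, (u != v) ==> adj G u v].

Definition transitive_on n (D : {set 'I_n * 'I_n}) (S : {set 'I_n}) : bool :=
  [forall u in S, forall v in S, forall w in S,
     ((u, v) \in D) ==> ((v, w) \in D) ==> ((u, w) \in D)].

(* Number of orientations of G in which every copy of K_r is transitive. *)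
Definition num_orient (r n : nat) (G : {set vpair n}) : nat :=
  #|[set D : {set 'I_n * 'I_n} | orientation G D &&
      [forall S : {set 'I_n},
         (#|S| == r) && clique G S ==> transitive_on D S]]|.

Definition gnp_mass (R : realType) n (p : R) (G : {set vpair n}) : R :=
  \prod_(e : vpair n) (if e \in G then p else 1 - p).

(* Probability, under G(n, p), of the graph property P. *)
Definition gnp_prob (R : realType) n (p : R) (P : {set vpair n} -> bool) : R :=
  \sum_(G : {set vpair n} | P G) gnp_mass p G.

Lemma adj_sym n (G : {set vpair n}) : symmetric (adj G).
Proof. by move=> u v; rewrite /adj finset.setUC. Qed.

Lemma adj_irrefl n (G : {set vpair n}) : irreflexive (adj G).
Proof.
move=> u; apply/existsP => -[e /andP[_ /eqP eu]].
by have := valP e; rewrite /= eu finset.setUid cards1.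
Qed.

Lemma gnp_mass_ge0 (R : realType) n (p : R) (G : {set vpair n}) :
  0 <= p <= 1 -> 0 <= gnp_mass p G.
Proof.
by move=> /andP[p0 p1]; apply: prodr_ge0 => e _; case: ifP; rewrite ?subr_ge0.
Qed.

Lemma gnp_mass_sum1 (R : realType) n (p : R) :
  \sum_(G : {set vpair n}) gnp_mass p G = 1.
Proof.
transitivity (\prod_(e : vpair n) (p + (1 - p))).
  by rewrite bigA_distr; apply: eq_bigl.
by apply: big1 => e _; rewrite addrC subrK.
Qed.

(* Main.v *)
(** For an orientation [D] in which every K_r is transitive and a set [K] of arcs of [D]
    already known, revealing all arcs at a vertex [y] determines every arc [x -> w] with
    [x -> y -> w] and [x, y, w] in a common K_r.  For each [w], let [A_w] be the set of
    unknown in-neighbours of [w].  If every set of [a] neighbours of [w] contains two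
    vertices lying with [w] in a K_r, then by Turan [A_w] spans about [|A_w|^2 / 2a] pairs
    of this kind, and each of them makes one of its two vertices determine an unknown arc
    into [w].  On average a revealed arc therefore determines an [h / (a n)] proportion of
    the [h] unknown arcs, so that [O(a n ln n)] revealed bits determine the orientation.

    With high probability this applies with [a = O(ln n / p)]: for fixed [w] and [A] with
    [|A| = a], Janson's inequality for the copies of K_r made of [w], two vertices of [A]
    and [r - 3] other vertices gives a failure probability [n^(-3a)], which survives the
    union bound over [w] and [A].  The condition [n p^((r+2)/2) >= 1] is what makes a
    positive proportion of the triangles extend to a K_r. *)

Require Import Defs.
From mathcomp Require Import all_boot all_order all_algebra.
From mathcomp Require Import all_classical all_reals all_analysis.
From mathcomp Require Import zify ring lra.

Set Implicit Arguments.
Unset Strict Implicit.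
Unset Printing Implicit Defensive.

Import Order.TTheory GRing.Theory Num.Theory.
Import numFieldNormedType.Exports.

Local Open Scope ring_scope.

(** * Janson's inequality for random subsets *)

Definition bern (R : realType) (T : finType) (p : R) (G : {set T}) : R :=
  \prod_(e : T) (if e \in G then p else 1 - p).

Lemma bern_ge0 (R : realType) (T : finType) (p : R) (G : {set T}) :
  0 <= p <= 1 -> 0 <= bern p G.
Proof.
by move=> /andP[p0 p1]; apply: prodr_ge0 => e _; case: ifP; rewrite ?subr_ge0.
Qed.

Lemma sum_bern (R : realType) (T : finType) (p : R) :
  \sum_(G : {set T}) bern p G = 1.
Proof.
transitivity (\prod_(e : T) (p + (1 - p))).
  by rewrite bigA_distr; apply: eq_bigl.
by apply: big1 => e _; rewrite addrC subrK.
Qed.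

Lemma bern_setU1 (R : realType) (T : finType) (p : R) (e : T) (G : {set T}) :
  e \notin G -> p * bern p G = (1 - p) * bern p (e |: G).
Proof.
move=> eG; rewrite /bern [in LHS](bigD1 e) //= [in RHS](bigD1 e) //=.
rewrite finset.setU11 (negbTE eG) mulrCA; congr (_ * (_ * _)).
by apply: eq_bigr => i ie; rewrite finset.in_setU1 (negbTE ie).
Qed.

(** Adding [e] pairs the sets without [e] with those containing it, and the two masses are in ratio
    [1 - p] to [p]. Forcing [e] into a random set thus costs a factor [p]. *)
Lemma sum_bern_mem (R : realType) (T : finType) (p : R) (e : T)
    (f : {set T} -> R) :
  \sum_(G : {set T} | e \in G) bern p G * f G = p * \sum_(G : {set T}) bern p G * f (e |: G).
Proof.
have E1 : \sum_(G : {set T} | e \in G) bern p G * f (e |: G)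
        = \sum_(G : {set T} | e \in G) bern p G * f G.
  apply: eq_bigr => G eG; congr (_ * f _).
  by apply/finset.setUidPr; rewrite finset.sub1set.
have E2 : p * (\sum_(G : {set T} | e \notin G) bern p G * f (e |: G))
        = (1 - p) * \sum_(G : {set T} | e \in G) bern p G * f G.
  rewrite [in RHS](reindex_onto (fun G : {set T} => e |: G) (fun G => G :\ e)) /=; last first.
    by move=> G eG; rewrite finset.setD1K.
  rewrite !mulr_sumr; apply: eq_big => [G|G eG].
    rewrite finset.setU11 /=; apply/idP/eqP => [eG|<-]; first by rewrite finset.setU1K.
    by rewrite finset.setD11.
  by rewrite !mulrA (bern_setU1 _ eG).
rewrite [X in _ = p * X](bigID (fun G : {set T} => e \in G)) /= mulrDr E2 E1 -mulrDl.
by rewrite addrC subrK mul1r.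
Qed.

(* Conditioning on [E \subset G] amounts to adding [E] to [G]; it replaces both
   independence and Harris' inequality. *)
Lemma sum_bern_sub (R : realType) (T : finType) (p : R) (E : {set T})
    (f : {set T} -> R) :
  \sum_(G : {set T} | E \subset G) bern p G * f G
  = p ^+ #|E| * \sum_(G : {set T}) bern p G * f (E :|: G).
Proof.
elim: {E}#|E| {-2}E (erefl #|E|) f => [|k IH] E Ek f.
  move/eqP: Ek; rewrite cards_eq0 => /eqP ->.
  rewrite cards0 expr0 mul1r; apply: eq_big => [G|G _]; first by rewrite finset.sub0set.
  by rewrite finset.set0U.
have [e eE] : exists e, e \in E by apply/finset.set0Pn; rewrite -cards_eq0 Ek.
have Dk : #|E :\ e| = k by move: Ek; rewrite (cardsD1 e) eE => -[].
transitivity (\sum_(G : {set T} | e \in G)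
   bern p G * ((E :\ e \subset G)%:R * f G)).
  rewrite [RHS](bigID (fun G : {set T} => E :\ e \subset G)) /=.
  rewrite [X in _ = _ + X]big1 ?addr0; last first.
    by move=> G /andP[_ /negbTE ->]; rewrite mul0r mulr0.
  apply: eq_big => [G|G EG]; first by rewrite -{1}(finset.setD1K eE) finset.subUset finset.sub1set.
  by rewrite (fintype.subset_trans (finset.subsetDl _ _) EG) mul1r.
rewrite sum_bern_mem Ek exprS -mulrA; congr (_ * _).
have -> : \sum_(G : {set T}) bern p G * f (E :|: G)
   = \sum_(G : {set T}) bern p G * f (e |: (E :\ e :|: G)).
  by apply: eq_bigr => G _; rewrite finset.setUA finset.setD1K.
rewrite -[in p ^+ k]Dk -(IH _ Dk (fun G => f (e |: G))).
rewrite [RHS]big_mkcond /=; apply: eq_bigr => G _.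
have -> : (E :\ e \subset e |: G) = (E :\ e \subset G).
  apply/idP/idP => [/fintype.subsetP S|S].
    apply/fintype.subsetP => x xE; have := S x xE.
    by move: xE; rewrite !inE => /andP[/negbTE ->].
  exact: fintype.subset_trans S (finset.subsetUr _ _).
by case: ifP; rewrite ?mul1r ?mul0r ?mulr0.
Qed.

Lemma bern_sub (R : realType) (T : finType) (p : R) (E : {set T}) :
  \sum_(G : {set T} | E \subset G) bern p G = p ^+ #|E|.
Proof.
have := sum_bern_sub p E (fun=> 1).
under eq_bigr do rewrite mulr1.
under [X in _ * X]eq_bigr do rewrite mulr1.
by rewrite sum_bern mulr1.
Qed.

(** Some set has positive mass, so [X > c] everywhere would push the average above [c]. This
    extracts one good subfamily from a random one. *)
Lemma bern_le_average (R : realType) (T : finType) (p c : R) (X : {set T} -> R) :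
  0 <= p <= 1 -> \sum_(G : {set T}) bern p G * X G <= c -> exists G, X G <= c.
Proof.
move=> p01 avg; apply: contrapT => H.
have H' G : c < X G by rewrite ltNge; apply/negP => ?; apply: H; exists G.
have [G G0] : exists G : {set T}, 0 < bern p G.
  apply: contrapT => N; have := sum_bern T p; rewrite big1 => [/eqP|G _].
    by rewrite eq_sym oner_eq0.
  apply/eqP; rewrite eq_le bern_ge0 // andbT leNgt.
  by apply/negP => ?; apply: N; exists G.
have : c < \sum_(G : {set T}) bern p G * X G.
  rewrite -[c]mul1r -(sum_bern T p) mulr_suml.
  rewrite (bigD1 G) //= [X in _ < X](bigD1 G) //=.
  apply: ltr_leD; first by rewrite ltr_pM2l.
  by apply: ler_sum => F _; rewrite ler_wpM2l ?bern_ge0 // ltW.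
by rewrite ltNge avg.
Qed.

Definition avoids (T I : finType) (E : I -> {set T}) (J : {set I})
    (G : {set T}) : bool := [forall i in J, ~~ (E i \subset G)].

Lemma avoids_setU1 (T I : finType) (E : I -> {set T}) (J : {set I}) i G :
  avoids E (i |: J) G = ~~ (E i \subset G) && avoids E J G.
Proof.
apply/forall_inP/andP => [H|[Hi /forall_inP HJ] j].
  split; first by apply: H; rewrite finset.setU11.
  by apply/forall_inP => j jJ; apply: H; rewrite finset.in_setU1 jJ orbT.
by rewrite finset.in_setU1 => /predU1P[->|/HJ].
Qed.

Lemma avoids_anti (T I : finType) (E : I -> {set T}) (J : {set I})
    (F G : {set T}) :
  F \subset G -> avoids E J G -> avoids E J F.
Proof.
move=> FG /forall_inP H; apply/forall_inP => i /H.
by apply: contra => /fintype.subset_trans ->.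
Qed.

Lemma ler_sum_impl (R : realType) (T : finType) (P Q : pred T) (F : T -> R) :
  (forall x, P x -> Q x) -> (forall x, 0 <= F x) ->
  \sum_(x | P x) F x <= \sum_(x | Q x) F x.
Proof.
move=> PQ F0; rewrite [leLHS]big_mkcond [leRHS]big_mkcond /=.
by apply: ler_sum => x _; case: ifP => [/PQ ->|_] //; case: ifP.
Qed.

(** The family [J1] of those [j] with [E j] disjoint from [E i] is independent of [E i]: containing
    [E i] and avoiding [J1] has mass [p ^+ #|E i| * C]. Passing from [J1] to [J] loses at most
    [d * C]. Avoiding [i] as well therefore multiplies [P] by at most [1 - p ^+ #|E i| + d]. *)
Lemma janson_step (R : realType) (T I : finType) (p : R) (E : I -> {set T})
    (J : {set I}) (i : I) : 0 <= p <= 1 ->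
  \sum_(G : {set T} | avoids E (i |: J) G) bern p G <=
  (\sum_(G : {set T} | avoids E J G) bern p G) *
    expR (- p ^+ #|E i| +
          \sum_(j in J | ~~ [disjoint E i & E j]) p ^+ #|E i :|: E j|).
Proof.
move=> p01; have b0 := bern_ge0 _ p01.
set P := \sum_(G | avoids E J G) bern p G.
set d := \sum_(j in J | _) _.
have P0 : 0 <= P by apply: sumr_ge0 => G _; rewrite b0.
apply: (@le_trans _ _ (P * (1 + (- p ^+ #|E i| + d)))); last first.
  by rewrite ler_wpM2l ?expR_ge1Dx.
set J1 := [set j in J | [disjoint E i & E j]].
set C := \sum_(G : {set T} | avoids E J1 G) bern p G.
have PC : P <= C.
  apply: ler_sum_impl => // G /forall_inP H; apply/forall_inP => j.
  by rewrite inE => /andP[/H].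
(* If [d] is at least [p ^+ #|E i|], the factor is at least 1 and monotonicity suffices. Otherwise
   the coefficient is positive and [C] may be replaced by the smaller [P]. *)
have [neg|pos] := lerP (p ^+ #|E i| - d) 0.
  rewrite -[leLHS]mulr1 ler_pM ?sumr_ge0 //; last by lra.
  by apply: ler_sum_impl => // G; rewrite avoids_setU1 => /andP[].
have split : P = \sum_(G : {set T} | avoids E (i |: J) G) bern p G
    + \sum_(G : {set T} | (E i \subset G) && avoids E J G) bern p G.
  rewrite /P (bigID (fun G : {set T} => E i \subset G)) /= addrC.
  by congr (_ + _); apply: eq_bigl => G; rewrite ?avoids_setU1 andbC.
have indep : \sum_(G : {set T} | (E i \subset G) && avoids E J1 G) bern p G
    = p ^+ #|E i| * C.
  have := sum_bern_sub p (E i) (fun G => (avoids E J1 G)%:R).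
  have -> : \sum_(G : {set T}) bern p G * (avoids E J1 (E i :|: G))%:R = C.
    rewrite /C [RHS]big_mkcond; apply: eq_bigr => G _.
    have -> : avoids E J1 (E i :|: G) = avoids E J1 G.
      apply/idP/idP; first exact/avoids_anti/finset.subsetUr.
      move=> /forall_inP H; apply/forall_inP => j jJ; have := H j jJ.
      apply: contra => /fintype.subsetP S; apply/fintype.subsetP => x xj.
      have := S x xj; rewrite inE => /orP[xi|//].
      move: jJ; rewrite inE => /andP[_ /pred0P /(_ x)] /=.
      by rewrite xi xj.
    by case: ifP; rewrite ?mulr1 ?mulr0.
  move=> <-; rewrite big_mkcondr /=; apply: eq_bigr => G _.
  by case: ifP; rewrite ?mulr1 ?mulr0.
have union : \sum_(G : {set T} | (E i \subset G) && avoids E J1 G) bern p G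
    <= \sum_(G : {set T} | (E i \subset G) && avoids E J G) bern p G
     + \sum_(j in J | ~~ [disjoint E i & E j])
         \sum_(G : {set T} | E i :|: E j \subset G) bern p G * (avoids E J1 G)%:R.
  (* A set that avoids [J1] but not [J] contains some [E j] meeting [E i], so the double sum counts
     it. *)
  rewrite (bigID (avoids E J)) /=; apply: lerD.
    by apply: ler_sum_impl => // G /andP[/andP[-> _] ->].
  rewrite (exchange_big_dep xpredT) //= [leLHS]big_mkcond /=.
  apply: ler_sum => G _.
  have S0 : 0 <= \sum_(j in J | ~~ [disjoint E i & E j] &&
      (E i :|: E j \subset G)) bern p G * (avoids E J1 G)%:R.
    by apply: sumr_ge0 => j _; rewrite mulr_ge0 // ler0n.
  under eq_bigl do rewrite -andbA.
  case: ifP => // /andP[/andP[iG AJ1] /forall_inPn [j jJ]]; rewrite negbK => jG.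
  have nd : ~~ [disjoint E i & E j].
    apply/negP => dj; move/forall_inP: AJ1 => /(_ j); rewrite inE jJ dj jG.
    by move=> /(_ isT).
  rewrite (bigD1 j) /=; last by rewrite jJ nd finset.subUset iG jG.
  rewrite AJ1 mulr1 lerDl; apply: sumr_ge0 => ? _; exact: b0.
have corr : \sum_(j in J | ~~ [disjoint E i & E j])
         \sum_(G : {set T} | E i :|: E j \subset G) bern p G * (avoids E J1 G)%:R
   <= d * C.
  rewrite /d mulr_suml; apply: ler_sum => j _; rewrite sum_bern_sub.
  rewrite ler_wpM2l ?exprn_ge0 //; first by case/andP: p01.
  rewrite /C [leRHS]big_mkcond; apply: ler_sum => G _.
  case A: (avoids E J1 _); last by rewrite mulr0; case: ifP.
  by rewrite (avoids_anti _ A) ?finset.subsetUr // mulr1.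
have : (p ^+ #|E i| - d) * P <= (p ^+ #|E i| - d) * C by rewrite ler_pM2l.
rewrite indep in union; lra.
Qed.

(** Indices are added one at a time. Each unordered pair arises only once on the way, so the sum
    over ordered pairs leaves slack. *)
Lemma janson (R : realType) (T I : finType) (p : R) (E : I -> {set T})
    (J : {set I}) : 0 <= p <= 1 ->
  \sum_(G : {set T} | avoids E J G) bern p G <=
  expR (- (\sum_(i in J) p ^+ #|E i|)
    + \sum_(i in J) \sum_(j in J | (j != i) && ~~ [disjoint E i & E j])
         p ^+ #|E i :|: E j|).
Proof.
move=> p01; have p0 : 0 <= p by case/andP: p01.
elim: {J}#|J| {-2}J (erefl #|J|) => [|k IH] J Jk.
  move/eqP: Jk; rewrite cards_eq0 => /eqP ->; rewrite !finset.big_set0 oppr0 addr0 expR0.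
  rewrite -(sum_bern T p); apply: ler_sum_impl => // G; exact: bern_ge0.
have [i iJ] : exists i, i \in J by apply/finset.set0Pn; rewrite -cards_eq0 Jk.
have Dk : #|J :\ i| = k by move: Jk; rewrite (cardsD1 i) iJ => -[].
rewrite -{1}(finset.setD1K iJ); apply: (le_trans (janson_step _ _ _ p01)).
apply: (le_trans (ler_wpM2r (expR_ge0 _) (IH _ Dk))).
rewrite -expRD ler_expR (big_setD1 i iJ) /= [in leRHS](big_setD1 i iJ) /=.
have : \sum_(j in J :\ i) \sum_(l in J :\ i | (l != j) &&
    ~~ [disjoint E j & E l]) p ^+ #|E j :|: E l|
  <= \sum_(j in J :\ i) \sum_(l in J | (l != j) &&
    ~~ [disjoint E j & E l]) p ^+ #|E j :|: E l|.
  apply: ler_sum => j _; apply: ler_sum_impl => [l|l]; last exact: exprn_ge0.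
  by rewrite finset.in_setD1 -andbA => /and3P[_ -> ->].
have -> : \sum_(j in J :\ i | ~~ [disjoint E i & E j]) p ^+ #|E i :|: E j|
  = \sum_(j in J | (j != i) && ~~ [disjoint E i & E j]) p ^+ #|E i :|: E j|.
  by apply: eq_bigl => j; rewrite finset.in_setD1 andbCA andbA.
lra.
Qed.

(* Janson's inequality for a random subfamily, each event being kept with
   probability [q]; this makes the correlation term quadratic in [q]. *)
Lemma janson_sparse (R : realType) (T I : finType) (p q : R)
    (E : I -> {set T}) (J : {set I}) : 0 <= p <= 1 -> 0 <= q <= 1 ->
  \sum_(G : {set T} | avoids E J G) bern p G <=
  expR (- q * (\sum_(i in J) p ^+ #|E i|)
    + q ^+ 2 * \sum_(i in J) \sum_(j in J | ~~ [disjoint E i & E j])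
         p ^+ #|E i :|: E j|).
Proof.
move=> p01 q01; have p0 : 0 <= p by case/andP: p01.
(* [X K] is the exponent of [janson] for [J :&: K]. For a [q]-random [K], an index survives with
   probability [q] and two distinct ones with probability [q ^+ 2], so some [K] does at least as
   well as the average. *)
pose X (K : {set I}) : R := - (\sum_(i in J) (i \in K)%:R * p ^+ #|E i|)
  + \sum_(i in J) \sum_(j in J | (j != i) && ~~ [disjoint E i & E j])
       ([set i; j] \subset K)%:R * p ^+ #|E i :|: E j|.
have mE (S : {set I}) : \sum_(K : {set I}) bern q K * (S \subset K)%:R = q ^+ #|S|.
  rewrite -bern_sub [RHS]big_mkcond; apply: eq_bigr => K _.
  by case: ifP; rewrite ?mulr1 ?mulr0.
have [K KX] : exists K, X K <= - q * (\sum_(i in J) p ^+ #|E i|)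
    + q ^+ 2 * \sum_(i in J) \sum_(j in J | ~~ [disjoint E i & E j])
         p ^+ #|E i :|: E j|.
  apply: (bern_le_average q01).
  under eq_bigr do rewrite mulrDr mulrN !mulr_sumr.
  rewrite big_split /= sumrN exchange_big /= [X in _ + X]exchange_big /=.
  apply: lerD.
    rewrite mulNr lerN2 mulr_sumr; apply: ler_sum => i _.
    under eq_bigr do rewrite mulrA -finset.sub1set.
    by rewrite -mulr_suml mE cards1 expr1.
  rewrite mulr_sumr; apply: ler_sum => i iJ.
  under eq_bigr do rewrite mulr_sumr.
  rewrite exchange_big mulr_sumr /=.
  rewrite [leLHS]big_mkcond [leRHS]big_mkcond /=; apply: ler_sum => j _.
  case: ifP => [/and3P[-> ij ->]|_] /=.
    under eq_bigr do rewrite mulrA.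
    by rewrite -mulr_suml mE cards2 eq_sym ij.
  by case: ifP => // _; rewrite mulr_ge0 ?exprn_ge0 //; case/andP: q01.
apply: (@le_trans _ _ (\sum_(G : {set T} | avoids E (J :&: K) G) bern p G)).
  apply: ler_sum_impl => [G /forall_inP H|G]; last exact: bern_ge0.
  by apply/forall_inP => i; rewrite inE => /andP[/H].
apply: (le_trans (janson _ _ p01)); rewrite ler_expR; apply: le_trans KX.
rewrite /X; apply: lerD.
  rewrite lerN2 [leRHS]big_mkcond [leLHS]big_mkcond.
  apply: ler_sum => i _; rewrite finset.in_setI; case: (i \in J) => //=.
  by case: (i \in K); rewrite ?mul1r ?mul0r.
rewrite [leRHS]big_mkcond [leLHS]big_mkcond.
apply: ler_sum => i _; rewrite finset.in_setI; case: (i \in J) => //=.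
case iK: (i \in K); last first.
  by apply: sumr_ge0 => j _; rewrite mulr_ge0 ?exprn_ge0 ?ler0n.
rewrite [leRHS]big_mkcond [leLHS]big_mkcond.
apply: ler_sum => j _; rewrite finset.in_setI; case: (j \in J) => //=.
rewrite finset.subUset !finset.sub1set iK; case: (j \in K) => /=.
  by rewrite mul1r.
by case: ifP; rewrite ?mul0r.
Qed.

(** * Partite copies of a pattern *)

(** A pattern is a graph on ['I_r], given by its set [Q] of two-element edges; a transversal places
    pattern vertex [l] in the part [V l]. *)
Definition transversals (n r : nat) (V : 'I_r -> {set 'I_n}) :
  {set {ffun 'I_r -> 'I_n}} := [set f : {ffun 'I_r -> 'I_n} | [forall l, f l \in V l]].

Definition copy (n r : nat) (Q : {set {set 'I_r}}) (f : {ffun 'I_r -> 'I_n}) :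
  {set vpair n} := [set e : vpair n | [exists q in Q, val e == f @: q]].

Definition agree (n r : nat) (f g : {ffun 'I_r -> 'I_n}) : {set 'I_r} :=
  [set l | f l == g l].

Definition induced (r : nat) (Q : {set {set 'I_r}}) (T : {set 'I_r}) :
  {set {set 'I_r}} := [set q in Q | q \subset T].

Lemma card_family_set (aT rT : finType) (V : aT -> {set rT}) :
  #|[set f : {ffun aT -> rT} | [forall l, f l \in V l]]|
  = (\prod_l #|V l|)%N.
Proof.
transitivity (\prod_l \sum_(x in V l) 1)%N; last first.
  by apply: eq_bigr => l _; rewrite sum1_card.
rewrite bigA_distr_big_dep -sum1_card.
apply: eq_big => [f|f _]; last by rewrite big1_eq.
by rewrite inE; apply/forallP/familyP.
Qed.

Lemma card_agree (n r : nat) (V : 'I_r -> {set 'I_n}) (f : {ffun 'I_r -> 'I_n})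
    (T : {set 'I_r}) :
  (#|[set g in transversals V | agree f g == T]| <= \prod_(l in ~: T) #|V l|)%N.
Proof.
rewrite big_mkcond /=.
rewrite (eq_bigr (fun l => #|if l \in ~: T then V l else [set f l]|)); last first.
  by move=> l _; case: ifP => // _; rewrite cards1.
rewrite -card_family_set; apply: subset_leq_card; apply/fintype.subsetP => g.
rewrite !inE => /andP[/forallP gV /eqP <-]; apply/forallP => l.
by rewrite !inE; case: eqP => [->|_] /=; rewrite ?inE.
Qed.

Lemma transversal_pi (n r : nat) (V : 'I_r -> {set 'I_n}) (part : 'I_n -> 'I_r)
    (f : {ffun 'I_r -> 'I_n}) :
  (forall l x, x \in V l -> part x = l) -> f \in transversals V -> cancel f part.
Proof. by move=> piV; rewrite inE => /forallP fV l; apply: piV. Qed.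

Lemma card_copy (n r : nat) (Q : {set {set 'I_r}}) (f : {ffun 'I_r -> 'I_n}) :
  (forall q, q \in Q -> #|q| = 2%N) -> injective f -> #|copy Q f| = #|Q|.
Proof.
move=> Q2 finj; rewrite -(card_imset _ val_inj).
rewrite -(card_imset Q (imset_inj finj)); apply: eq_card => s.
apply/imsetP/imsetP => [[e] | [q qQ ->]].
  by rewrite inE => /exists_inP[q qQ /eqP eq] ->; exists q.
have c2 : #|f @: q| == 2%N by rewrite card_imset // Q2.
exists (Sub (f @: q) c2) => //; rewrite inE.
by apply/exists_inP; exists q.
Qed.

(** As [part] recovers the label of a vertex, an edge shared by two copies comes from the same
    pattern edge in both, and both of its ends are placed alike. *)
Lemma card_copyI (n r : nat) (V : 'I_r -> {set 'I_n}) (part : 'I_n -> 'I_r)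
    (Q : {set {set 'I_r}}) (f g : {ffun 'I_r -> 'I_n}) :
  (forall l x, x \in V l -> part x = l) ->
  f \in transversals V -> g \in transversals V ->
  (#|copy Q f :&: copy Q g| <= #|induced Q (agree f g)|)%N.
Proof.
move=> piV fV gV.
have fK := transversal_pi piV fV; have gK := transversal_pi piV gV.
have piE (h : {ffun 'I_r -> 'I_n}) (q : {set 'I_r}) : cancel h part -> part @: (h @: q) = q.
  by move=> hK; rewrite -imset_comp (eq_imset _ hK) imset_id.
have inj : {in copy Q f :&: copy Q g &, injective (fun e : vpair n => part @: val e)}.
  move=> e e'; rewrite !inE => /andP[/exists_inP[q _ /eqP E] _].
  move=> /andP[/exists_inP[q' _ /eqP E'] _]; rewrite E E' !piE // => qq.
  by apply: val_inj; rewrite E E' qq.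
rewrite -(card_in_imset inj); apply: subset_leq_card.
apply/fintype.subsetP => _ /imsetP[e + ->].
rewrite !inE => /andP[/exists_inP[q qQ /eqP E] /exists_inP[q' _ /eqP E']].
rewrite E piE // qQ /=; apply/fintype.subsetP => l lq.
have : f l \in f @: q by apply: imset_f.
rewrite -E E' => /imsetP[l' _ fl]; rewrite inE.
by rewrite {2}(_ : l = l') ?fl //; rewrite -(fK l) fl gK.
Qed.

(** Overlapping pairs of copies are grouped by the set [T] on which they agree. Each [T] contributes
    at most [mu ^+ 2] over the expected number of copies of the pattern induced on [T], which is at
    least [X]. There are [2 ^ r] sets [T], and the full one gives [X <= mu]. *)
Lemma partite_janson (R : realType) (n r : nat) (p X : R)
    (V : 'I_r -> {set 'I_n}) (part : 'I_n -> 'I_r) (Q : {set {set 'I_r}}) :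
  0 <= p <= 1 -> 0 < X -> (forall l x, x \in V l -> part x = l) ->
  (forall q, q \in Q -> #|q| = 2%N) -> (0 < #|Q|)%N ->
  (forall T : {set 'I_r}, (0 < #|induced Q T|)%N ->
     X <= (\prod_(l in T) #|V l|%:R) * p ^+ #|induced Q T|) ->
  \sum_(G : {set vpair n} | avoids (copy Q) (transversals V) G) bern p G
  <= expR (- (X / 2 ^+ (r + 2))).
Proof.
move=> p01 X0 piV Q2 Q0 XT; have /andP[p0 p1] := p01.
set J := transversals V.
have cE f : f \in J -> #|copy Q f| = #|Q|.
  by move=> fJ; apply: card_copy => //; apply: can_inj (transversal_pi piV fJ).
set mu := (\prod_l #|V l|%:R) * p ^+ #|Q| : R.
have muX : X <= mu.
  have QT : induced Q finset.setT = Q by apply/setP => q; rewrite inE finset.subsetT andbT.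
  have := XT finset.setT; rewrite QT => /(_ Q0); rewrite /mu.
  by congr (_ <= _ * _); apply: eq_bigl => l; rewrite inE.
have mu0 : 0 < mu by exact: lt_le_trans muX.
have muE : \sum_(f in J) p ^+ #|copy Q f| = mu.
  rewrite (eq_bigr (fun=> p ^+ #|Q|)); last by move=> f /cE ->.
  by rewrite sumr_const card_family_set -mulr_natl natr_prod.
have Delta : \sum_(f in J) \sum_(g in J | ~~ [disjoint copy Q f & copy Q g])
    p ^+ #|copy Q f :|: copy Q g| <= 2 ^+ r * (mu ^+ 2 / X).
  have inner f : f \in J ->
     \sum_(g in J | ~~ [disjoint copy Q f & copy Q g])
        p ^+ #|copy Q f :|: copy Q g| <= 2 ^+ r * (mu * p ^+ #|Q| / X).
    move=> fJ.
    apply: (@le_trans _ _ (\sum_(g in J | (0 < #|induced Q (agree f g)|)%N)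
       p ^+ (2 * #|Q| - #|induced Q (agree f g)|))).
      rewrite [leLHS]big_mkcondr [leRHS]big_mkcondr /=; apply: ler_sum => g gJ.
      have cI := card_copyI Q piV fJ gJ.
      case: ifP => [nd|_]; last by case: ifP => // _; exact: exprn_ge0.
      have -> : (0 < #|induced Q (agree f g)|)%N.
        by apply: leq_trans cI; rewrite card_gt0 finset.setI_eq0.
      by apply: ler_wiXn2l => //; rewrite cardsU !cE // mul2n -addnn leq_sub2l.
    rewrite (partition_big (fun g => agree f g) xpredT) //=.
    have -> : 2 ^+ r * (mu * p ^+ #|Q| / X) =
        \sum_(T : {set 'I_r}) mu * p ^+ #|Q| / X.
      rewrite sumr_const -[RHS]mulr_natl; congr (_ * _).
      rewrite -natrX; congr (_%:R).
      by have := card_powerset [set: 'I_r]; rewrite powersetT !cardsT card_ord.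
    apply: ler_sum => T _.
    have [Q0T|Q1T] := leqP #|induced Q T| 0.
      rewrite big1; first exact: divr_ge0 (mulr_ge0 (ltW mu0) (exprn_ge0 _ p0)) (ltW X0).
      move=> g /andP[/andP[_ +] /eqP E]; rewrite E.
      by rewrite ltnNge Q0T.
    have QT : (#|induced Q T| <= #|Q|)%N.
      by apply: subset_leq_card; apply/fintype.subsetP => q; rewrite inE => /andP[].
    apply: (@le_trans _ _ ((\prod_(l in ~: T) #|V l|%:R)
        * p ^+ (2 * #|Q| - #|induced Q T|))).
      rewrite [leLHS](eq_bigr (fun=> p ^+ (2 * #|Q| - #|induced Q T|))); last first.
        by move=> g /andP[_ /eqP ->].
      rewrite sumr_const -[leLHS]mulr_natl ler_wpM2r ?exprn_ge0 //.
      rewrite -natr_prod ler_nat; apply: leq_trans (card_agree V f T).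
      apply: subset_leq_card; apply/fintype.subsetP => g.
      by move=> /andP[/andP[gJ _] gT]; rewrite inE gJ.
    rewrite ler_pdivlMr // mulrAC.
    have -> : mu * p ^+ #|Q| = \prod_(l in ~: T) #|V l|%:R
        * ((\prod_(l in T) #|V l|%:R) * p ^+ #|induced Q T|)
        * p ^+ (2 * #|Q| - #|induced Q T|).
      rewrite /mu (bigID (fun l => l \in T)) /=.
      rewrite [X in _ * X * _ * _](eq_bigl (fun l => l \in ~: T)); last first.
        by move=> l; rewrite inE.
      have -> : p ^+ #|Q| = p ^+ #|induced Q T| * p ^+ (#|Q| - #|induced Q T|).
        by rewrite -exprD subnKC.
      have -> : (2 * #|Q| - #|induced Q T|
          = #|induced Q T| + (#|Q| - #|induced Q T|) + (#|Q| - #|induced Q T|))%N.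
        by move: QT; lia.
      rewrite !exprD.
      move: (\prod_(l in T) _) (\prod_(l in ~: T) _) (p ^+ #|induced Q T|)
        (p ^+ (_ - _)) => x y z t.
      ring.
    rewrite ler_wpM2r ?exprn_ge0 // ler_wpM2l ?XT //.
    by apply: prodr_ge0 => l _; rewrite ler0n.
  apply: (@le_trans _ _ (\sum_(f in J) 2 ^+ r * (mu * p ^+ #|Q| / X))).
    exact: ler_sum.
  rewrite sumr_const card_family_set -[leLHS]mulr_natl natr_prod.
  rewrite le_eqVlt; apply/orP; left; apply/eqP.
  transitivity (2 ^+ r * (mu * ((\prod_l #|V l|%:R) * p ^+ #|Q|) / X)).
    move: (\prod_l _) (p ^+ #|Q|) (2 ^+ r) => x y z; ring.
  by rewrite -/mu expr2.
(* This [q] minimises [- q * mu + q ^+ 2 * (2 ^+ r * (mu ^+ 2 / X))], with value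
   [- X / 2 ^+ (r + 2)]; it is at most 1 because [X <= mu]. *)
pose q := X / (2 ^+ r.+1 * mu).
have d0 : 0 < 2 ^+ r.+1 * mu by rewrite mulr_gt0 ?exprn_gt0 ?ltr0n.
have q01 : 0 <= q <= 1.
  rewrite divr_ge0 ?(ltW X0) ?(ltW d0) //= ler_pdivrMr // mul1r.
  apply: (le_trans muX); rewrite ler_peMl ?(ltW mu0) //.
  by rewrite exprn_ege1 // ler1n.
apply: (le_trans (janson_sparse (copy Q) J p01 q01)).
rewrite ler_expR muE.
have : q ^+ 2 * (\sum_(f in J) \sum_(g in J | ~~ [disjoint copy Q f & copy Q g])
    p ^+ #|copy Q f :|: copy Q g|) <= q ^+ 2 * (2 ^+ r * (mu ^+ 2 / X)).
  by rewrite ler_wpM2l ?sqr_ge0.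
have z0 : (2 ^+ r : R) != 0 by rewrite expf_neq0 // pnatr_eq0.
have mun0 : mu != 0 by rewrite gt_eqF.
have Xn0 : X != 0 by rewrite gt_eqF.
have e2 : 2 ^+ (r + 2) = 4 * 2 ^+ r :> R by rewrite exprD; ring.
have e1 : 2 ^+ r.+1 = 2 * 2 ^+ r :> R by rewrite exprS.
have -> : q ^+ 2 * (2 ^+ r * (mu ^+ 2 / X)) = X / 2 ^+ (r + 2).
  rewrite /q e1 e2; move: (2 ^+ r) z0 => z z0.
  by field; rewrite z0 mun0 ?Xn0.
have -> : - q * mu = - (2 * (X / 2 ^+ (r + 2))).
  rewrite /q e1 e2; move: (2 ^+ r) z0 => z z0.
  by field; rewrite z0 mun0 ?Xn0.
lra.
Qed.

(** * Counting orientations by revealing stars *)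

Lemma subset_of_card (T : finType) (A : {set T}) k :
  (k <= #|A|)%N -> exists2 B : {set T}, B \subset A & #|B| = k.
Proof.
move=> kA; have : (0 < #|[set B : {set T} | B \subset A & #|B| == k]|)%N.
  by rewrite cards_draws bin_gt0.
by case/card_gt0P => B; rewrite inE => /andP[BA /eqP]; exists B.
Qed.

Definition arcs_in (T : finType) (q : rel T) (A : {set T}) : {set T * T} :=
  [set u | [&& u.1 \in A, u.2 \in A & q u.1 u.2]].

(* If [I] is a maximal [q]-independent subset of [A] then [#|I| <= a] and every
   vertex of [A :\: I] is joined to [I] by an arc; induct on [A :\: I]. *)
Lemma turan_arcs (T : finType) (q : rel T) (a : nat) (A : {set T}) :
  irreflexive q ->
  (forall B : {set T}, B \subset A -> #|B| = a ->
     exists x y, [&& x \in B, y \in B & q x y]) ->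
  (#|A| ^ 2 <= 2 * a * #|arcs_in q A| + 2 * a * #|A|)%N.
Proof.
move=> q_irr; have [k] := ubnP #|A|; elim: k A => // k IH A Ak dep.
have [->|[x xA]] := set_0Vmem A; first by rewrite cards0.
pose P (B : {set T}) := (B \subset A) && (arcs_in q B == finset.set0).
have Px : P [set x].
  rewrite /P finset.sub1set xA; apply/eqP/setP => u; rewrite !inE.
  by apply/negP => /and3P[/eqP -> /eqP ->]; rewrite q_irr.
have [I maxI xI] := maxset_exists Px.
have /andP[IA /eqP I0] := maxsetp maxI.
have Ia : (#|I| <= a)%N.
  rewrite leqNgt; apply/negP => /ltnW /subset_of_card[B BI Ba].
  have [y [z /and3P[yB zB qyz]]] := dep _ (fintype.subset_trans BI IA) Ba.
  have : (y, z) \in arcs_in q I.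
    by rewrite inE /= !(fintype.subsetP BI).
  by rewrite I0 inE.
have Ipos : (0 < #|I|)%N.
  by apply/card_gt0P; exists x; apply: (fintype.subsetP xI); rewrite inE.
have DA : #|A :\: I| = (#|A| - #|I|)%N by rewrite cardsDS.
have IA' := subset_leq_card IA.
have IHD : (#|A :\: I| ^ 2 <= 2 * a * #|arcs_in q (A :\: I)| + 2 * a * #|A :\: I|)%N.
  apply: IH => [|B BA Ba]; first by rewrite DA; lia.
  by apply: dep => //; apply: fintype.subset_trans BA (finset.subsetDl _ _).
(* These are the arcs between [I] and [A :\: I]. By maximality of [I], every vertex outside it is an
   end of one of them. *)
pose X := [set u in arcs_in q A | (u.1 \in I) (+) (u.2 \in I)].
have XD : (#|A :\: I| <= #|X|)%N.
  apply: leq_trans (leq_imset_card (fun u : T * T => if u.1 \in I then u.2 else u.1) X).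
  apply: subset_leq_card; apply/fintype.subsetP => v.
  rewrite inE => /andP[vI vA].
  have : ~~ P (v |: I).
    apply/negP => PvI; have /maxsetP[_ /(_ _ PvI (finset.subsetUr _ _)) E] := maxI.
    by move: vI; rewrite -E finset.setU11.
  rewrite /P finset.subUset finset.sub1set vA IA /= => /set0Pn[[y z]].
  rewrite !inE /= => /and3P[yI zI qyz].
  have IAP := fintype.subsetP IA.
  have nyz : ~~ ((y \in I) && (z \in I)).
    apply/negP => /andP[yI' zI']; have : (y, z) \in arcs_in q I by rewrite inE /= yI' zI'.
    by rewrite I0 inE.
  case/predU1P: yI => [yv|yI].
    case/predU1P: zI => [zv|zI]; first by move: qyz; rewrite yv zv q_irr.
    apply/imsetP; exists (y, z) => /=; last by rewrite yv (negbTE vI).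
    by rewrite !inE /= yv vA (negbTE vI) zI IAP // -yv qyz.
  have zv : z = v.
    by case/predU1P: zI => [//|zI]; move: nyz; rewrite yI zI.
  apply/imsetP; exists (y, z) => /=; last by rewrite yI zv.
  by rewrite !inE /= zv vA (negbTE vI) yI IAP // -zv qyz.
have sum : (#|arcs_in q (A :\: I)| + #|X| <= #|arcs_in q A|)%N.
  rewrite -cardsUI (_ : _ :&: X = finset.set0) ?cards0 ?addn0.
    apply: subset_leq_card; apply/fintype.subsetP => u; rewrite !inE.
    case/orP => [/and3P[/andP[_ ->] /andP[_ ->] ->]//|/andP[]//].
  apply/setP => u; rewrite !inE; apply/negP.
  by case/andP => /and3P[/andP[/negbTE -> _] /andP[/negbTE -> _] _] /andP[].
move: IHD sum XD; rewrite DA.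
move: #|arcs_in q (A :\: I)| #|X| #|arcs_in q A| #|A| #|I| Ia Ipos IA'.
clear=> e' x' e A I Ia Ipos IA IHD sum XD.
(* Writing [A] and [a] as sums removes the truncated subtractions and leaves a polynomial
   inequality. *)
have [d dE] : exists d, A = (d + I)%N by exists (A - I)%N; rewrite subnK.
have [b bE] : exists b, a = (b + I)%N by exists (a - I)%N; rewrite subnK.
subst; rewrite addnK in IHD XD; nia.
Qed.

(** * Deducing arcs from transitivity *)

Definition triad (r n : nat) (G : {set vpair n}) (x y w : 'I_n) : bool :=
  [exists S : {set 'I_n},
     [&& #|S| == r, clique G S, x \in S, y \in S & w \in S]].

Definition valid (r n : nat) (G : {set vpair n}) (D : {set 'I_n * 'I_n}) : bool :=
  orientation G D &&
      [forall S : {set 'I_n},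
         (#|S| == r) && clique G S ==> transitive_on D S].

Definition extensions (r n : nat) (G : {set vpair n}) (K : {set 'I_n * 'I_n}) :=
  [set D | valid r G D & K \subset D].

Definition swap (T : Type) (u : T * T) : T * T := (u.2, u.1).

Definition star (n : nat) (D : {set 'I_n * 'I_n}) (y : 'I_n) : {set 'I_n * 'I_n} :=
  [set u in D | (u.1 == y) || (u.2 == y)].

(** A single round of deduction is enough for the count, so no transitive closure is taken. *)
Definition infer (r n : nat) (G : {set vpair n}) (D : {set 'I_n * 'I_n}) :
  {set 'I_n * 'I_n} :=
  D :|: [set u | [exists y, [&& (u.1, y) \in D, (y, u.2) \in D
                              & triad r G u.1 y u.2]]].

Definition unknown (n : nat) (G : {set vpair n}) (K : {set 'I_n * 'I_n})
    (y : 'I_n) : {set 'I_n} :=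
  [set x | [&& adj G x y, (x, y) \notin K & (y, x) \notin K]].

Definition gain (r n : nat) (G : {set vpair n}) (K D : {set 'I_n * 'I_n})
    (y : 'I_n) : {set 'I_n * 'I_n} :=
  [set u in D :\: K | [&& (u.1, y) \in D, (y, u.2) \in D & triad r G u.1 y u.2]].

Lemma orientation_adj (n : nat) (G : {set vpair n}) D x y :
  orientation G D -> adj G x y = ((x, y) \in D) || ((y, x) \in D).
Proof. by move=> /forallP/(_ x)/forallP/(_ y)/andP[/eqP]. Qed.

Lemma orientation_anti (n : nat) (G : {set vpair n}) D x y :
  orientation G D -> (x, y) \in D -> (y, x) \notin D.
Proof.
by move=> /forallP/(_ x)/forallP/(_ y)/andP[_]; rewrite negb_and => /orP[/negbTE ->|].
Qed.

Lemma orientation_flip (n : nat) (G : {set vpair n}) D x y :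
  orientation G D -> adj G x y -> (x, y) \notin D -> (y, x) \in D.
Proof. by move=> oD; rewrite (orientation_adj _ _ oD) => /orP[->|]. Qed.

Lemma valid_triad (r n : nat) (G : {set vpair n}) D x y w :
  valid r G D -> triad r G x y w -> (x, y) \in D -> (y, w) \in D -> (x, w) \in D.
Proof.
case/andP=> _ /forallP tr /existsP[S /and5P[Sr SG xS yS wS]] xy yw.
have /implyP := tr S; rewrite Sr SG => /(_ isT).
by move=> /forall_inP/(_ x xS)/forall_inP/(_ y yS)/forall_inP/(_ w wS); rewrite xy yw.
Qed.

Lemma infer_sub (r n : nat) (G : {set vpair n}) (D R : {set 'I_n * 'I_n}) :
  valid r G D -> R \subset D -> infer r G R \subset D.
Proof.
move=> vD RD; rewrite finset.subUset RD; apply/fintype.subsetP => -[x w].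
rewrite inE => /existsP[y /= /and3P[xy yw t]].
by apply: (valid_triad vD t); apply: (fintype.subsetP RD).
Qed.

(** All orientations of [G] have equally many arcs, so the number of unknown arcs of an extension of
    [K] depends on [K] only. *)
Lemma card_orientation (n : nat) (G : {set vpair n}) D : orientation G D ->
  #|D| = (#|[set u : 'I_n * 'I_n | adj G u.1 u.2]|)./2.
Proof.
move=> oD.
have swapI : injective (@swap 'I_n) by move=> [x y] [z t] [-> ->].
have -> : [set u : 'I_n * 'I_n | adj G u.1 u.2] = D :|: @swap _ @: D.
  apply/setP => -[x y]; rewrite !inE /= (orientation_adj _ _ oD).
  congr (_ || _); apply/idP/imsetP => [yx|[[z t] zt [-> ->]]//].
  by exists (y, x).
rewrite cardsU card_imset // (_ : _ :&: _ = finset.set0).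
  by rewrite cards0 subn0 addnn doubleK.
apply/setP => u; rewrite !inE; apply/negP => /andP[uD /imsetP[[z t] zt uE]].
by move: uD; rewrite uE; apply/negP/(orientation_anti oD).
Qed.

(** One bit per unknown edge suffices: an extension is determined by where it agrees with the fixed
    [D] outside [K]. This ends the recursion when few arcs are unknown. *)
Lemma card_extensions_pow (r n : nat) (G : {set vpair n})
    (K D : {set 'I_n * 'I_n}) :
  D \in extensions r G K -> (#|extensions r G K| <= 2 ^ #|D :\: K|)%N.
Proof.
rewrite inE => /andP[/andP[oD _] KD].
have half (A B : {set 'I_n * 'I_n}) : A \in extensions r G K -> B \in extensions r G K ->
    A :&: (D :\: K) = B :&: (D :\: K) -> A \subset B.
  rewrite !inE => /andP[/andP[oA _] KA] /andP[/andP[oB _] KB] E.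
  apply/fintype.subsetP => -[x y] xyA.
  have Exy u : (u \in A) && (u \in D :\: K) = (u \in B) && (u \in D :\: K).
    by move/setP: E => /(_ u); rewrite !finset.in_setI.
  have [xyK|xyK] := boolP ((x, y) \in K); first exact: (fintype.subsetP KB).
  have adjxy : adj G x y by rewrite (orientation_adj _ _ oA) xyA.
  have [xyD|xyD] := boolP ((x, y) \in D).
    by have := Exy (x, y); rewrite inE xyA xyK xyD => /esym/andP[].
  have yxD := orientation_flip oD adjxy xyD.
  have yxA := orientation_anti oA xyA.
  have yxK : (y, x) \notin K by apply: contra yxA; apply: (fintype.subsetP KA).
  have := Exy (y, x); rewrite inE (negbTE yxA) yxK yxD /= andbT => yxB.
  by apply: (orientation_flip oB); [rewrite adj_sym | rewrite -yxB].
rewrite -card_powerset.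
have inj : {in extensions r G K &, injective (fun A => A :&: (D :\: K))}.
  move=> A B AK BK E; apply/eqP.
  by rewrite finset.eqEsubset (half _ _ AK BK E) (half _ _ BK AK (esym E)).
rewrite -(card_in_imset inj); apply: subset_leq_card.
by apply/fintype.subsetP => _ /imsetP[A _ ->]; rewrite inE finset.subsetIr.
Qed.

(** Edges at [y] already oriented by [K] are the same in all extensions, so only the unknown ones
    carry a bit. *)
Lemma card_stars (r n : nat) (G : {set vpair n}) K y
    (U : {set {set 'I_n * 'I_n}}) : U \subset extensions r G K ->
  (#|[set star D y | D in U]| <= 2 ^ #|unknown G K y|)%N.
Proof.
move=> UK.
pose code (R : {set 'I_n * 'I_n}) := [set x in unknown G K y | (x, y) \in R].
have half (A B : {set 'I_n * 'I_n}) : A \in U -> B \in U ->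
    code (star A y) = code (star B y) -> star A y \subset star B y.
  move=> /(fintype.subsetP UK) + /(fintype.subsetP UK).
  rewrite !inE => /andP[/andP[oA _] KA] /andP[/andP[oB _] KB] E.
  have codeE x : x \in unknown G K y -> ((x, y) \in A) = ((x, y) \in B).
    by rewrite inE => xU; move/setP: E => /(_ x); rewrite !inE /= xU eqxx orbT !andbT.
  apply/fintype.subsetP => -[x z]; rewrite !inE /= => /andP[xzA].
  move=> /[dup] xz ->; rewrite andbT.
  have [xzK|xzK] := boolP ((x, z) \in K); first exact: (fintype.subsetP KB).
  have zxA := orientation_anti oA xzA.
  have zxK : (z, x) \notin K by apply: contra zxA; apply: (fintype.subsetP KA).
  have adjxz : adj G x z by rewrite (orientation_adj _ _ oA) xzA.
  case/orP: xz => /eqP E'; subst.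
    have zU : z \in unknown G K y by rewrite inE adj_sym adjxz zxK xzK.
    apply: (orientation_flip oB); first by rewrite adj_sym.
    by rewrite -codeE.
  by rewrite -codeE // inE adjxz xzK.
rewrite -card_powerset.
have inj : {in [set star D y | D in U] &, injective code}.
  move=> _ _ /imsetP[A AU ->] /imsetP[B BU ->] E; apply/eqP.
  by rewrite finset.eqEsubset (half _ _ AU BU E) (half _ _ BU AU (esym E)).
rewrite -(card_in_imset inj); apply: subset_leq_card.
apply/fintype.subsetP => _ /imsetP[A _ ->]; rewrite inE.
by apply/fintype.subsetP => x; rewrite inE => /andP[].
Qed.

Lemma card_infer_star (r n : nat) (G : {set vpair n}) (K D : {set 'I_n * 'I_n}) y :
  K \subset D -> (#|K| + #|gain r G K D y| <= #|K :|: infer r G (star D y)|)%N.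
Proof.
move=> KD; rewrite -cardsUI (_ : K :&: _ = finset.set0) ?cards0 ?addn0.
  apply/subset_leq_card/finset.setUS/fintype.subsetP => u.
  rewrite inE => /andP[_ /and3P[uy yu t]]; rewrite !inE; apply/orP; right.
  by apply/existsP; exists y; rewrite !inE /= !eqxx uy yu t orbT.
apply/setP => u; rewrite !inE.
by case: (u \in K).
Qed.

(** The only property of the random graph that the counting uses: among the neighbours of [w], the
    pairs in a common K_r with [w] leave no independent set of size [a]. *)
Definition dense_triads (r n : nat) (G : {set vpair n}) (a : nat) : Prop :=
  forall (w : 'I_n) (A : {set 'I_n}), #|A| = a -> (forall x, x \in A -> adj G x w) ->
    exists x y, [&& x \in A, y \in A, x != y & triad r G x y w].

Lemma triad_adj (r n : nat) (G : {set vpair n}) x y w :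
  triad r G x y w -> x != y -> adj G x y.
Proof.
move=> /existsP[S /and5P[_ /forall_inP SG xS yS _]] xy.
by have /forall_inP/(_ y yS)/implyP/(_ xy) := SG x xS.
Qed.

Lemma triadC (r n : nat) (G : {set vpair n}) x y w : triad r G x y w = triad r G y x w.
Proof. by apply: eq_existsb => S; congr (_ && (_ && _)); rewrite andbCA. Qed.

Lemma card_pairs (T : finType) (P : T -> T -> bool) :
  #|[set u : T * T | P u.1 u.2]| = (\sum_x \sum_y P x y)%N.
Proof.
rewrite -sum1_card pair_big /= [LHS]big_mkcond /=.
by apply: eq_bigr => u _; rewrite inE; case: (P _ _).
Qed.

(** An arc [x -> y] inside [A w], in a triad with [w], puts [(x, w)] into the gain of [y]. The bound
    of [turan_arcs] is summed over [w]; the hypothesis on [#|D :\: K|] lets its linear term be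
    absorbed into half of the left side. *)
Lemma sum_gain (r n : nat) (G : {set vpair n}) (a : nat) (K D : {set 'I_n * 'I_n}) :
  valid r G D -> dense_triads r G a -> (0 < n)%N -> (0 < a)%N ->
  (4 * a * n <= #|D :\: K|)%N ->
  (#|D :\: K| ^ 2 <= 4 * a * n * \sum_y #|gain r G K D y|)%N.
Proof.
move=> vD dt n0 a0; set h := #|D :\: K| => hbig.
have oD : orientation G D by case/andP: vD.
pose A (w : 'I_n) := [set x | (x, w) \in D :\: K].
pose q w x y := ((x, y) \in D) && triad r G x y w.
have sumA : (\sum_w #|A w| = h)%N.
  rewrite /h (_ : D :\: K = [set u | (fun x y => (x, y) \in D :\: K) u.1 u.2]); last first.
    by apply/setP => -[x y]; rewrite !inE.
  rewrite (card_pairs (fun x y => (x, y) \in D :\: K)) exchange_big /=.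
  apply: eq_bigr => w _.
  by rewrite -sum1_card [LHS]big_mkcond; apply: eq_bigr => x _; rewrite !inE; case: (_ && _).
have sume : (\sum_w #|arcs_in (q w) (A w)| <= \sum_y #|gain r G K D y|)%N.
  have -> : (\sum_y #|gain r G K D y| = \sum_y \sum_x \sum_w
      [&& (x, w) \in D :\: K, (x, y) \in D, (y, w) \in D & triad r G x y w])%N.
    apply: eq_bigr => y _; rewrite -(card_pairs (fun x w => [&& (x, w) \in D :\: K,
      (x, y) \in D, (y, w) \in D & triad r G x y w])); apply: eq_card => -[x w].
    by rewrite !inE.
  rewrite [leqRHS]exchange_big /=; under [leqRHS]eq_bigr do rewrite exchange_big /=.
  rewrite [leqRHS]exchange_big /=; apply: leq_sum => w _.
  rewrite (card_pairs (fun x y => [&& x \in A w, y \in A w & q w x y])).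
  apply: leq_sum => x _; apply: leq_sum => y _.
  rewrite /q !inE; case: (_ \in K) => //=; case: ((x, w) \in D) => //=.
  by case: ((y, w) \in K) => //=; case: ((y, w) \in D); rewrite ?andbF.
have tur w : (#|A w| ^ 2 <= 2 * a * #|arcs_in (q w) (A w)| + 2 * a * #|A w|)%N.
  apply: turan_arcs => [x|B BA Ba].
    rewrite /q; apply/negP => /andP[xx _].
    by have := orientation_anti oD xx; rewrite xx.
  have [|x [y /and4P[xB yB xy t]]] := dt w B Ba.
    move=> x /(fintype.subsetP BA); rewrite !inE => /andP[_ xw].
    by rewrite (orientation_adj _ _ oD) xw.
  have := triad_adj t xy; rewrite (orientation_adj _ _ oD) => /orP[xyD|yxD].
    by exists x, y; rewrite /q xB yB xyD.
  by exists y, x; rewrite /q xB yB yxD triadC.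
(* Cauchy-Schwarz over the naturals, by summing [2 * h * (n * #|A w|) <= h ^ 2 + (n * #|A w|) ^ 2]
   over [w]. *)
have cs : (h ^ 2 <= n * \sum_w #|A w| ^ 2)%N.
  have E w : (2 * h * (n * #|A w|) <= h ^ 2 + n ^ 2 * #|A w| ^ 2)%N.
    by have [+ _] := nat_Cauchy h (n * #|A w|); rewrite expnMn mulnA.
  have : (\sum_(w < n) 2 * h * (n * #|A w|) <= \sum_(w < n) (h ^ 2 + n ^ 2 * #|A w| ^ 2))%N.
    exact: leq_sum.
  rewrite big_split /= sum_nat_const card_ord -!big_distrr /= sumA.
  by move: (\sum_w _)%N => S; nia.
have turs : (\sum_w #|A w| ^ 2 <=
    2 * a * (\sum_w #|arcs_in (q w) (A w)|) + 2 * a * h)%N.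
  rewrite -sumA !big_distrr -big_split /=; exact: leq_sum.
move: cs turs sume hbig.
move: (\sum_w #|A w| ^ 2)%N (\sum_w #|arcs_in (q w) (A w)|)%N.
move: (\sum_y #|gain r G K D y|)%N => g s e cs turs sume hbig.
have : (2 * a * n * h * 2 <= h * h)%N by nia.
have : (n * s <= n * (2 * a * g + 2 * a * h))%N by rewrite leq_mul2l; nia.
nia.
Qed.

(** * Choosing the vertex to reveal, and the recursion *)

Lemma leq_card_cover (T I : finType) (A : {set T}) (U : I -> {set T}) :
  (forall x, x \in A -> exists i, x \in U i) -> (#|A| <= \sum_i #|U i|)%N.
Proof.
move=> AU; under eq_bigr do rewrite -sum1_card.
rewrite (exchange_big_dep xpredT) //= -sum1_card big_mkcond /=.
apply: leq_sum => x _; case: ifP => // /AU[i xi].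
by rewrite (bigD1 i).
Qed.

Lemma sum_unknown (n : nat) (G : {set vpair n}) (K D : {set 'I_n * 'I_n}) :
  orientation G D -> (\sum_y #|unknown G K y| <= 2 * #|D :\: K|)%N.
Proof.
move=> oD.
have sumD : (\sum_y \sum_x ((x, y) \in D :\: K))%N = #|D :\: K|.
  rewrite exchange_big -(card_pairs (fun x y => (x, y) \in D :\: K)) /=.
  by apply: eq_card => -[x y]; rewrite !inE.
have sumD' : (\sum_y \sum_x ((y, x) \in D :\: K))%N = #|D :\: K|.
  rewrite -(card_pairs (fun x y => (x, y) \in D :\: K)) /=.
  by apply: eq_card => -[x y]; rewrite !inE.
rewrite mul2n -addnn -{1}sumD -sumD' -big_split /=; apply: leq_sum => y _.
rewrite -big_split /= -sum1_card [leqLHS]big_mkcond /=; apply: leq_sum => x _.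
rewrite !inE (orientation_adj _ _ oD).
by case: ((x, y) \in K); case: ((y, x) \in K); case: (_ \in D); case: (_ \in D).
Qed.

(** Averaging over [y], with [h] unknown arcs: by [sum_gain] the right sides total at least
    [6 * h ^ 2]. The left sides total at most [(2 * h + n * L) * (1 + h)], which is below that since
    [n * L <= h / 4]. *)
Lemma exists_gain (R : realType) (r n : nat) (G : {set vpair n}) (a : nat) (L : R)
    (K D : {set 'I_n * 'I_n}) :
  valid r G D -> dense_triads r G a -> (0 < n)%N -> (0 < a)%N ->
  0 <= L <= a%:R -> (4 * a * n <= #|D :\: K|)%N ->
  exists y, (#|unknown G K y|%:R + L) * (1 + #|D :\: K|%:R)
            <= (24 * a * n)%:R * #|gain r G K D y|%:R.
Proof.
move=> vD dt n0 a0 /andP[L0 La] hbig; set h := #|D :\: K|.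
apply: contrapT => H.
have H' y : (24 * a * n)%:R * #|gain r G K D y|%:R
    < (#|unknown G K y|%:R + L) * (1 + h%:R).
  by rewrite ltNge; apply/negP => ?; apply: H; exists y.
have : (24 * a * n)%:R * (\sum_y #|gain r G K D y|)%:R
    < (2 * h%:R + n%:R * L) * (1 + h%:R).
  apply: (@lt_le_trans _ _ ((\sum_y (#|unknown G K y|%:R + L)) * (1 + h%:R))).
    rewrite natr_sum mulr_sumr mulr_suml; apply: ltr_sum => //.
    by apply/hasP; exists (Ordinal n0); rewrite ?mem_index_enum.
  rewrite ler_pM2r; last by rewrite ltr_pwDl.
  rewrite big_split /= sumr_const card_ord -[L *+ n]mulr_natl lerD2r.
  rewrite -natr_sum -natrM ler_nat; apply: sum_unknown.
  by case/andP: vD.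
have := sum_gain vD dt n0 a0 hbig; rewrite -/h.
move: (\sum_y _)%N => g; rewrite -(ler_nat R) !natrM.
have : (4 * a * n)%:R <= h%:R :> R by rewrite ler_nat.
rewrite !natrM.
have : 1 <= a%:R :> R by rewrite ler1n.
have : 1 <= n%:R :> R by rewrite ler1n.
move: La; move: h%:R a%:R n%:R g%:R => x b m s Lb m1 b1 hbig' hs.
have mL : m * L <= m * b by rewrite ler_wpM2l //; lra.
have bm1 : 1 <= b * m by nra.
have -> : 24 * b * m * s = 6 * (4 * b * m * s) by ring.
rewrite ltNge => /negP; apply.
have : (2 * x + m * L) * (1 + x) <= (9 / 4 * x) * (2 * x).
  by apply: ler_pM; nra.
nra.
Qed.

Lemma ln_drop (R : realType) (x y : R) : 0 < x -> 0 < y ->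
  ln y <= ln x - (x - y) / x.
Proof.
move=> x0 y0; have yx0 : 0 < y / x by rewrite divr_gt0.
have -> : ln y = ln x + ln (y / x).
  by rewrite -lnM ?posrE // mulrC divfK // gt_eqF.
rewrite lerD2l mulrBl divff ?gt_eqF // opprB.
have := @le_ln1Dx R (y / x - 1); rewrite (addrC 1) subrK; apply; lra.
Qed.

(** The exponent serves as a potential in the number [h] of unknown arcs. Revealing the star of a
    good [y] lowers it by at least [#|unknown G K y| + ln n]: the first term pays for the possible
    stars, the second for the choice of [y]. Once [h <= 4 * a * n], all remaining arcs are
    revealed. *)
Lemma card_extensions_le (R : realType) (r n a : nat) (G : {set vpair n})
    (K : {set 'I_n * 'I_n}) :
  dense_triads r G a -> (1 < n)%N -> (0 < a)%N -> ln n%:R <= a%:R :> R ->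
  #|extensions r G K|%:R <= expR ((4 * a * n)%:R + (24 * a * n)%:R *
     ln (1 + ((#|[set u : 'I_n * 'I_n | adj G u.1 u.2]|)./2 - #|K|)%:R)) :> R.
Proof.
move=> dt n1 a0 La; set m := (_)./2.
have n0 : (0 < n)%N by apply: ltnW.
have L0 : 0 < ln n%:R :> R by rewrite ln_gt0 // ltr1n.
have L0a : 0 <= (ln n%:R : R) <= a%:R by rewrite ltW.
have [k] := ubnP (m - #|K|); elim: k K => // k IH K Kk.
set h := (m - #|K|)%N.
have hE D : D \in extensions r G K -> #|D :\: K| = h.
  rewrite inE => /andP[/andP[oD _] KD].
  by rewrite cardsDS // (card_orientation oD).
have [->|[D0 D0K]] := set_0Vmem (extensions r G K).
  by rewrite cards0 expR_ge0.
have lnh (j : nat) : 0 <= ln (1 + j%:R) :> R by rewrite ln_ge0 // lerDl.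
have [small|big] := leqP h (4 * a * n).
  have := card_extensions_pow D0K; rewrite (hE _ D0K) -(ler_nat R) => /le_trans; apply.
  apply: (@le_trans _ _ (expR h%:R)).
    rewrite natrX -[h%:R]mulr1 expRM_natl lerXn2r ?nnegrE ?expR_ge0 //.
    by have := @expR_ge1Dx R 1; rewrite -[1 + 1]/(2 : R).
  rewrite ler_expR; apply: (@le_trans _ _ (4 * a * n)%:R); first by rewrite ler_nat.
  by rewrite lerDl mulr_ge0.
pose good D y := (#|unknown G K y|%:R + ln n%:R) * (1 + h%:R)
            <= (24 * a * n)%:R * #|gain r G K D y|%:R :> R.
pose U y := [set D in extensions r G K | good D y].
set phi := (4 * a * n)%:R + (24 * a * n)%:R * ln (1 + h%:R) : R.
(* The good vertex depends on the orientation, so the extensions are covered by [n] classes, one for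
   each [y]. *)
have cover : (#|extensions r G K| <= \sum_y #|U y|)%N.
  apply: leq_card_cover => D DK; move: (DK); rewrite inE => /andP[vD KD].
  have [|y gy] := @exists_gain R r n G a _ K D vD dt n0 a0 L0a; first by rewrite (hE _ DK) ltnW.
  by exists y; rewrite inE DK /= /good -(hE _ DK).
have branch y S : S \in [set star D y | D in U y] ->
   #|extensions r G (K :|: infer r G S)|%:R
     <= expR (phi - (#|unknown G K y|%:R + ln n%:R)) :> R.
  case/imsetP => D; rewrite inE => /andP[DK gD] ->.
  (* A positive gain makes the number of unknown arcs drop strictly, as the induction requires. *)
  have gpos : (0 < #|gain r G K D y|)%N.
    rewrite lt0n; apply/negP => /eqP g0; move: gD; rewrite /good g0 mulr0.
    by rewrite leNgt mulr_gt0 // ?ltr_wpDl // ltr_pwDl.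
  have := hE _ DK; move: DK; rewrite inE => /andP[vD KD] hD.
  have cK := card_infer_star r G y KD.
  have gh : (#|gain r G K D y| <= h)%N.
    rewrite -hD; apply: subset_leq_card; apply/fintype.subsetP => u.
    by rewrite inE => /andP[].
  have hlt : (m - #|K :|: infer r G (star D y)| <= h - #|gain r G K D y|)%N.
    by rewrite /h -subnDA leq_sub2l.
  apply: (le_trans (IH _ _)).
    by apply: leq_ltn_trans hlt _; rewrite -ltnS (leq_trans _ Kk) // -/h ltnS ltn_subrL gpos (leq_trans gpos gh).
  rewrite ler_expR /phi -addrA lerD2l.
  have M0 : 0 <= (24 * a * n)%:R :> R by rewrite ler0n.
  have h0 : 0 < 1 + h%:R :> R by rewrite ltr_pwDl.
  apply: (@le_trans _ _ ((24 * a * n)%:R *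
      (ln (1 + h%:R) - #|gain r G K D y|%:R / (1 + h%:R)))).
    apply: ler_wpM2l => //.
    apply: (@le_trans _ _ (ln (1 + (h - #|gain r G K D y|)%:R))).
      by rewrite ler_ln ?posrE ?ltr_pwDl // lerD2l ler_nat.
    have := @ln_drop R (1 + h%:R) (1 + (h - #|gain r G K D y|)%:R) h0.
    rewrite ltr_pwDl // => /(_ isT).
    have -> // : 1 + h%:R - (1 + (h - #|gain r G K D y|)%:R) = #|gain r G K D y|%:R :> R.
    by rewrite (natrB _ gh); ring.
  rewrite mulrBr lerD2l lerN2 mulrA ler_pdivlMr //.
have part y : (#|U y| <= \sum_(S in [set star D y | D in U y])
     #|extensions r G (K :|: infer r G S)|)%N.
  rewrite -sum1_card (partition_big_imset (fun D => star D y)) /=.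
  apply: leq_sum => S _; rewrite sum1dep_card; apply: subset_leq_card.
  apply/fintype.subsetP => D; rewrite !inE => /andP[/andP[/andP[vD KD] _] /eqP <-].
  rewrite vD finset.subUset KD infer_sub //.
  by apply/fintype.subsetP => u; rewrite inE => /andP[].
apply: (@le_trans _ _ (\sum_(y : 'I_n) expR phi / n%:R)); last first.
  rewrite sumr_const card_ord -[_ *+ n]mulr_natl mulrC divfK //.
  by rewrite pnatr_eq0 -lt0n.
apply: (@le_trans _ _ (\sum_y #|U y|)%:R); first by rewrite ler_nat.
rewrite natr_sum; apply: ler_sum => y _.
apply: (@le_trans _ _ (\sum_(S in [set star D y | D in U y])
     expR (phi - (#|unknown G K y|%:R + ln n%:R)))).
  apply: (@le_trans _ _ (\sum_(S in [set star D y | D in U y])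
     #|extensions r G (K :|: infer r G S)|)%:R); first by rewrite ler_nat.
  by rewrite natr_sum; apply: ler_sum => S; apply: branch.
rewrite sumr_const -[_ *+ _]mulr_natl.
set d := #|unknown G K y|.
have cS : #|[set star D y | D in U y]|%:R <= expR d%:R :> R.
  apply: (@le_trans _ _ (2 ^ d)%N%:R).
    rewrite ler_nat; apply: (@card_stars r n G K y (U y)).
    by apply/fintype.subsetP => D; rewrite inE => /andP[].
  rewrite natrX -[d%:R]mulr1 expRM_natl lerXn2r ?nnegrE ?expR_ge0 //.
  by have := @expR_ge1Dx R 1; rewrite -[1 + 1]/(2 : R).
apply: (le_trans (ler_wpM2r (expR_ge0 _) cS)).
have cancel (u v w : R) : u + (v - (u + w)) = v - w by ring.
rewrite -expRD cancel.
by rewrite expRD expRN lnK // posrE ltr0n.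
Qed.

Lemma num_orient_le (R : realType) (r n a : nat) (G : {set vpair n}) :
  dense_triads r G a -> (1 < n)%N -> (0 < a)%N -> 1 <= (ln n%:R : R) <= a%:R ->
  (num_orient r G)%:R <= expR (76 * (a%:R * n%:R * ln n%:R)) :> R.
Proof.
move=> dt n1 a0 /andP[L1 La].
have -> : num_orient r G = #|extensions r G finset.set0|.
  by apply: eq_card => D; rewrite !inE finset.sub0set andbT.
apply: (le_trans (card_extensions_le _ dt n1 a0 La)).
rewrite cards0 subn0 ler_expR; set m := (_)./2.
have n0 : 0 < n%:R :> R by rewrite ltr0n ltnW.
(* This crude bound gives [ln (1 + m) <= 3 * ln n]; with [1 <= ln n] the constant is
   [76 = 4 + 24 * 3]. *)
have mn : (1 + m <= n ^ 3)%N.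
  have : (m <= n ^ 2)%N.
    rewrite leq_half_double -addnn.
    have := max_card [set u : 'I_n * 'I_n | adj G u.1 u.2].
    by rewrite card_prod card_ord; nia.
  by rewrite !expnS expn0 !muln1; nia.
have : ln (1 + m%:R) <= 3 * ln n%:R :> R.
  rewrite mulr_natl -lnXn // ler_ln ?posrE ?exprn_gt0 ?ltr_pwDl //.
  by rewrite -natrX -[1]/(1%:R) -natrD ler_nat.
rewrite !natrM; move=> lm.
have an0 : 0 <= a%:R * n%:R :> R by rewrite mulr_ge0 // ltW.
have : a%:R * n%:R * ln (1 + m%:R) <= a%:R * n%:R * (3 * ln n%:R) :> R.
  by rewrite ler_wpM2l.
have : a%:R * n%:R * 1 <= a%:R * n%:R * ln n%:R :> R by rewrite ler_wpM2l.
lra.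
Qed.

(** * Triangles extending to a clique *)

Definition bad_pair (r n : nat) (w : 'I_n) (A : {set 'I_n}) (G : {set vpair n}) : bool :=
  [forall x in A, adj G x w] &&
  [forall x in A, forall y in A, (x != y) ==> ~~ triad r G x y w].

Lemma dense_triadsPn (r n a : nat) (G : {set vpair n}) : ~ dense_triads r G a ->
  exists w, exists2 A : {set 'I_n}, #|A| = a & bad_pair r w A G.
Proof.
move=> nd; apply: contrapT => H; apply: nd => w A Aa Aw.
apply: contrapT => H'; apply: H; exists w, A => //.
apply/andP; split; first by apply/forall_inP.
apply/forall_inP => x xA; apply/forall_inP => y yA; apply/implyP => xy.
by apply/negP => t; apply: H'; exists x, y; rewrite xA yA xy t.
Qed.

(* The edges of K_r except those joining vertex 2 (which is sent to [w]) to vertices 0 and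
   1 (which are sent to the neighbours [A] of [w]). *)
Definition link_pattern (k : nat) : {set {set 'I_k.+3}} :=
  [set q : {set 'I_k.+3} | (#|q| == 2%N) &&
     ~~ ((inord 2 \in q) && ((inord 0 \in q) || (inord 1 \in q)))].

(** Residue classes modulo [k] provide [k] explicit disjoint parts of nearly equal size; removing
    [w] and the sets [A1], [A2] separates them from the first three parts. *)
Definition link_parts (n k : nat) (A1 A2 : {set 'I_n}) (w : 'I_n) (l : 'I_k.+3) :
  {set 'I_n} :=
  match val l with
  | 0%N => A1
  | 1%N => A2
  | 2%N => [set w]
  | l'.+3 => [set x : 'I_n | (x %% k == l')%N] :\: (w |: (A1 :|: A2))
  end.

Lemma link_parts_label (n k : nat) (A1 A2 : {set 'I_n}) (w : 'I_n) :
  [disjoint A1 & A2] -> w \notin A1 :|: A2 ->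
  exists part : 'I_n -> 'I_k.+3,
    forall l x, x \in link_parts A1 A2 w l -> part x = l.
Proof.
move=> dA wA.
exists (fun x => if x \in A1 then inord 0 else if x \in A2 then inord 1
  else if x == w then inord 2 else inord (x %% k + 3)).
move=> l x; rewrite /link_parts; move: (ltn_ord l).
case E: (val l) => [|[|[|l']]] lk xV; apply: val_inj => /=.
- by rewrite xV inordK ?E.
- rewrite (disjointFl dA xV) xV inordK ?E //.
- move: wA xV; rewrite !inE negb_or => /andP[/negbTE wA1 /negbTE wA2] /eqP ->.
  by rewrite wA1 wA2 eqxx inordK ?E.
- move: xV; rewrite !inE !negb_or => /andP[/and3P[/negbTE -> /negbTE -> /negbTE ->]].
  by move=> /eqP ->; rewrite addn3 -E inordK.
Qed.

(** The pairs omitted from the pattern are edges anyway, as [bad_pair] joins [w] to all of [A1] and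
    [A2]. A copy of the pattern would thus complete a K_r through [w] and two distinct vertices of
    [A1 :|: A2]. *)
Lemma link_avoids (n k : nat) (A1 A2 : {set 'I_n}) (w : 'I_n) (G : {set vpair n}) :
  [disjoint A1 & A2] -> bad_pair k.+3 w (A1 :|: A2) G ->
  avoids (@copy n k.+3 (link_pattern k)) (transversals (link_parts A1 A2 w)) G.
Proof.
move=> dA /andP[/forall_inP Aw /forall_inP nt].
have wA : w \notin A1 :|: A2 by apply/negP => /Aw; rewrite adj_irrefl.
have [part partV] := link_parts_label k dA wA.
apply/forall_inP => f fV; apply/negP => /fintype.subsetP cG.
have finj : injective f := can_inj (transversal_pi partV fV).
move: fV; rewrite inE => /forallP fV.
have v0 : val (inord 0 : 'I_k.+3) = 0%N by rewrite /= inordK.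
have v1 : val (inord 1 : 'I_k.+3) = 1%N by rewrite /= inordK.
have v2 : val (inord 2 : 'I_k.+3) = 2%N by rewrite /= inordK.
have f0 : f (inord 0) \in A1 by have := fV (inord 0); rewrite /link_parts v0.
have f1 : f (inord 1) \in A2 by have := fV (inord 1); rewrite /link_parts v1.
have f2 : f (inord 2) = w.
  by have := fV (inord 2); rewrite /link_parts v2 inE => /eqP.
have fA l : (l == inord 0) || (l == inord 1) -> adj G (f l) w.
  by case/orP => /eqP ->; apply: Aw; rewrite inE ?f0 ?f1 ?orbT.
have clq : clique G (f @: [set: 'I_k.+3]).
  apply/forall_inP => _ /imsetP[l _ ->]; apply/forall_inP => _ /imsetP[m _ ->].
  apply/implyP => flm.
  have lm : l != m by apply: contraNneq flm => ->.
  have [|nq] := boolP ([set l; m] \in link_pattern k).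
    move=> lmQ; apply/existsP.
    have c2 : #|f @: [set l; m]| == 2%N by rewrite card_imset // cards2 lm.
    exists (Sub (f @: [set l; m]) c2); apply/andP; split; last first.
      by rewrite SubK imsetU1 imset_set1.
    by apply: cG; rewrite inE; apply/exists_inP; exists [set l; m].
  move: nq; rewrite !inE cards2 lm /= negbK => /andP[].
  have ne02 : (inord 0 == inord 2 :> 'I_k.+3) = false by rewrite -val_eqE v2 v0.
  have ne12 : (inord 1 == inord 2 :> 'I_k.+3) = false by rewrite -val_eqE v2 v1.
  case/orP => /eqP E; rewrite -E ne02 ne12 ?orbF /= => H.
    by rewrite f2 adj_sym fA // ![m == _]eq_sym.
  by rewrite f2 fA // ![l == _]eq_sym.
have f0A : f (inord 0) \in A1 :|: A2 by rewrite inE f0.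
have f1A : f (inord 1) \in A1 :|: A2 by rewrite inE f1 orbT.
have := nt _ f0A => /forall_inP/(_ _ f1A)/implyP.
have -> : f (inord 0) != f (inord 1).
  by apply/eqP => E; move: f1; rewrite -E (disjointFr dA f0).
move=> /(_ isT) /negP; apply; apply/existsP; exists (f @: [set: 'I_k.+3]).
by rewrite clq card_imset // cardsT card_ord eqxx -f2 !imset_f.
Qed.

Lemma double_bin2 m : (2 * 'C(m, 2) = m * m.-1)%N.
Proof. by rewrite bin2 mul2n; case: m => // m; rewrite /= halfK oddM /= andNb subn0. Qed.

(** Doubling avoids halves. The extremal case has vertex 2 in [T]: all pairs among [i + 1 + j]
    vertices, minus the [i] omitted pairs at vertex 2. *)
Lemma card_link_induced (k : nat) (T : {set 'I_k.+3}) (i j : nat) :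
  i = #|[set l in T | (l < 2)%N]| ->
  j = #|[set l in T | (2 < l)%N]| ->
  (2 * #|induced (link_pattern k) T| <= j * (j + 1 + 2 * i) + i * i.-1)%N.
Proof.
move=> iE jE.
have v0 : val (inord 0 : 'I_k.+3) = 0%N by rewrite /= inordK.
have v1 : val (inord 1 : 'I_k.+3) = 1%N by rewrite /= inordK.
have v2 : val (inord 2 : 'I_k.+3) = 2%N by rewrite /= inordK.
pose Z := [set l in T | (l == inord 0) || (l == inord 1)].
have cZ : #|Z| = i.
  rewrite iE; apply: eq_card => l; rewrite !inE -!val_eqE v0 v1.
  by case: (l \in T) => //=; case: (val l) => [|[|]].
have cT : #|T| = (i + (inord 2 \in T) + j)%N.
  rewrite -cZ jE -(cardsID Z T) -addnA; congr (_ + _)%N.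
    by apply: eq_card => l; rewrite !inE; case: (l \in T).
  rewrite -(cardsID [set inord 2] (T :\: Z)); congr (_ + _)%N.
    have [T2|T2] := boolP (inord 2 \in T).
      rewrite (_ : _ :&: _ = [set inord 2]) ?cards1 //; apply/setP => l; rewrite !inE.
      by apply/andP/eqP => [[_ /eqP]//|->]; rewrite T2 eqxx -!val_eqE v0 v1 v2.
    apply/eqP; rewrite cards_eq0; apply/eqP/setP => l; rewrite !inE.
    by apply/negP => /andP[/andP[_ lT] /eqP l2]; move: T2; rewrite -l2 lT.
  apply: eq_card => l; rewrite !inE -!val_eqE v0 v1 v2 /=.
  by case: (l \in T) => //=; case: (val l) => [|[|[|]]].
have sub2 : induced (link_pattern k) T \subset [set q : {set 'I_k.+3} | q \subset T & #|q| == 2%N].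
  by apply/fintype.subsetP => q; rewrite !inE => /andP[/andP[-> _] ->].
have := subset_leq_card sub2; rewrite cards_draws.
have [T2|T2] := boolP (inord 2 \in T); last first.
  move: cT; rewrite (negbTE T2) addn0 => -> le.
  have := double_bin2 (i + j); move: le; case: {iE cZ} i => [|i] /=; nia.
move=> _.
pose Ex := (fun l => [set inord 2; l]) @: Z.
have cEx : #|Ex| = i.
  rewrite -cZ; apply: card_in_imset => l m; rewrite !inE => /andP[_ l01] /andP[_ m01].
  move/setP => /(_ l); rewrite !inE eqxx orbT => /esym /orP[/eqP l2|/eqP//].
  by move: l01; rewrite l2 -!val_eqE v0 v1 v2.
have dis : [disjoint induced (link_pattern k) T & Ex].
  rewrite -finset.setI_eq0; apply/eqP/setP => q; rewrite !inE; apply/negP.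
  move=> /andP[/andP[/andP[_ nq] _] /imsetP[l]]; rewrite inE => /andP[_ l01] qE.
  move: nq; rewrite qE !inE eqxx /= ![_ == l]eq_sym => /negP; apply.
  by case/orP: l01 => ->; rewrite ?orbT.
have sub2' : induced (link_pattern k) T :|: Ex
    \subset [set q : {set 'I_k.+3} | q \subset T & #|q| == 2%N].
  rewrite finset.subUset sub2; apply/fintype.subsetP => q /imsetP[l].
  rewrite inE => /andP[lT l01] ->.
  rewrite inE finset.subUset !finset.sub1set T2 lT cards2 /=.
  by case/orP: l01 => /eqP ->; rewrite -val_eqE ?v0 ?v1 ?v2.
have := subset_leq_card sub2'; rewrite cards_draws cT T2.
rewrite cardsU (_ : _ :&: Ex = finset.set0); last by apply/eqP; rewrite finset.setI_eq0.
rewrite cards0 subn0 cEx => le; have := double_bin2 (i + 1 + j).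
by move: le; case: {iE cZ cT cEx} i => [|i] /=; nia.
Qed.

Lemma card_residue (n k l : nat) : (l < k)%N ->
  (n %/ k <= #|[set x : 'I_n | (x %% k == l)%N]|)%N.
Proof.
move=> lk.
have bnd (j : 'I_(n %/ k)) : (j * k + l < n)%N.
  have := ltn_ord j; have := leq_trunc_div n k; nia.
have inj : injective (fun j => Ordinal (bnd j)).
  by move=> i j [] /addIn /eqP; rewrite eqn_pmul2r ?(leq_ltn_trans _ lk) // => /eqP/val_inj.
rewrite -[leqLHS]card_ord -cardsT -(card_imset _ inj); apply: subset_leq_card.
apply/fintype.subsetP => _ /imsetP[j _ ->]; rewrite inE /= modnMDl.
by rewrite modn_small.
Qed.

Lemma card_link_parts (n k s : nat) (A1 A2 : {set 'I_n}) (w : 'I_n) (l : 'I_k.+3) :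
  #|A1| = s -> #|A2| = s -> (2 < l)%N ->
  (n %/ k - (2 * s).+1 <= #|link_parts A1 A2 w l|)%N.
Proof.
rewrite /link_parts => s1 s2; have := ltn_ord l.
case E: (val l) => [|[|[|l']]] lk; rewrite -[nat_of_ord l]/(val l) E // => _.
rewrite cardsD leq_sub //.
  by apply: card_residue; move: lk; rewrite -[nat_of_ord l]/(val l) E.
apply: leq_trans (subset_leq_card (finset.subsetIr _ _)) _.
rewrite cardsU1 cardsU s1 s2 mul2n -addnn -add1n; apply: leq_add; first by case: (_ \notin _).
exact: leq_subr.
Qed.

Lemma prod_link_parts (R : realType) (n k s : nat) (N : R)
    (A1 A2 : {set 'I_n}) (w : 'I_n) (T : {set 'I_k.+3}) :
  #|A1| = s -> #|A2| = s -> 0 <= N <= (n %/ k - (2 * s).+1)%:R ->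
  s%:R ^+ #|[set l in T | (l < 2)%N]| * N ^+ #|[set l in T | (2 < l)%N]|
  <= \prod_(l in T) #|link_parts A1 A2 w l|%:R.
Proof.
move=> s1 s2 /andP[N0 Nn].
have powE (c : R) (P : pred 'I_k.+3) :
    c ^+ #|[set l in T | P l]| = \prod_(l in T) (if P l then c else 1).
  rewrite -big_mkcondr /= -prodr_const; apply: eq_bigl => l.
  by rewrite inE.
rewrite !powE -big_split /=; apply: ler_prod => l _.
apply/andP; split.
  by rewrite mulr_ge0 //; case: ifP.
have [l2|l2] := ltnP 2 l.
  rewrite ltnNge (ltnW l2) /= mul1r; apply: (le_trans Nn).
  by rewrite ler_nat card_link_parts.
rewrite mulr1 /link_parts; case E: (val l) => [|[|[|l']]].
- by rewrite -[nat_of_ord l]/(val l) E s1.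
- by rewrite -[nat_of_ord l]/(val l) E s2.
- by rewrite -[nat_of_ord l]/(val l) E cards1.
- by move: l2; rewrite -[nat_of_ord l]/(val l) E.
Qed.

(* [s ^+ i * N ^+ j * u ^+ _] is, with [u ^+ 2 = p], a lower bound for the expected number of copies of the
   part of the pattern spanned by vertex 2, [i] vertices in [A] and [j] other vertices. *)
Lemma link_weight (R : realType) (s N u X c : R) (i j k : nat) :
  (i <= 2)%N -> (j <= k)%N -> 0 <= s -> 0 < u <= 1 -> 0 <= N -> 0 < c <= 1 ->
  X <= s ^+ 2 * u ^+ 2 * c ^+ k -> c <= N * u ^+ (k + 5) ->
  X <= s * (N * u ^+ (k + 3)) -> 1 <= N * u ^+ (k + 3) ->
  X <= N * u ^+ (k + 1) -> 1 <= N * u ^+ (k + 1) ->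
  (0 < j * (j + 1 + 2 * i) + i * i.-1)%N ->
  X <= s ^+ i * N ^+ j * u ^+ (j * (j + 1 + 2 * i) + i * i.-1).
Proof.
move=> i2 jk s0 /andP[u0 u1] N0 /andP[c0 c1] X2 N2 X1 N1 X0 N0' pos.
have -> : s ^+ i * N ^+ j * u ^+ (j * (j + 1 + 2 * i) + i * i.-1)
   = s ^+ i * u ^+ (i * i.-1) * (N * u ^+ (j + 1 + 2 * i)) ^+ j.
  by rewrite exprD mulnC exprMn -exprM; move: (u ^+ _) (u ^+ _) (N ^+ _) (s ^+ _); intros; ring.
have mono d : N * u ^+ (k + d) <= N * u ^+ (j + d).
  by rewrite ler_wpM2l // ler_wiXn2l ?(ltW u0) // leq_add2r.
have self (y : R) : (0 < j)%N -> 1 <= y -> y <= y ^+ j.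
  move=> j0 y1; rewrite -[leLHS]expr1; exact: ler_weXn2l.
(* For [i < 2] positivity forces [0 < j], and the base of the [j]-th power is at least 1, so [j = 1]
   is the worst case. For [i = 2] the base is only known to be at least [c <= 1], and [j = k] is the
   worst case. *)
case: i i2 pos => [|[|[|//]]] _.
- rewrite muln0 mul0n !addn0 muln_gt0 => /andP[j0 _].
  rewrite expr0 mul1r mul1r; apply: (le_trans X0); apply: (le_trans (mono 1%N)).
  by apply: self => //; apply: le_trans (mono 1%N).
- rewrite muln1 -addnA addn0 muln_gt0 => /andP[j0 _].
  rewrite expr0 mulr1 expr1; apply: (le_trans X1); rewrite ler_wpM2l //.
  apply: (le_trans (mono 3%N)).
  by apply: self => //; apply: le_trans (mono 3%N).
- rewrite -[(2 * 2)%N]/4%N -addnA.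
  move=> _; apply: (le_trans X2).
  rewrite ler_wpM2l ?mulr_ge0 ?exprn_ge0 ?(ltW u0) //.
  apply: (@le_trans _ _ (c ^+ j)); first by rewrite ler_wiXn2l ?(ltW c0).
  rewrite lerXn2r ?nnegrE ?(ltW c0) ?mulr_ge0 ?exprn_ge0 ?(ltW u0) //.
  exact: le_trans N2 (mono 5%N).
Qed.

(** The edge probability is written [u ^+ 2] so that the doubled edge counts become natural
    exponents of [u]. *)
Lemma link_janson (R : realType) (n k s : nat) (u N X c : R)
    (A1 A2 : {set 'I_n}) (w : 'I_n) :
  #|A1| = s -> #|A2| = s -> [disjoint A1 & A2] -> w \notin A1 :|: A2 ->
  0 <= N <= (n %/ k - (2 * s).+1)%:R -> 0 < u <= 1 -> 0 < c <= 1 -> 0 < X ->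
  X <= s%:R ^+ 2 * u ^+ 2 * c ^+ k -> c <= N * u ^+ (k + 5) ->
  X <= s%:R * (N * u ^+ (k + 3)) -> 1 <= N * u ^+ (k + 3) ->
  X <= N * u ^+ (k + 1) -> 1 <= N * u ^+ (k + 1) ->
  \sum_(G : {set vpair n} | avoids (@copy n k.+3 (link_pattern k))
     (transversals (link_parts A1 A2 w)) G) bern (u ^+ 2) G
  <= expR (- (X / 2 ^+ (k + 5))).
Proof.
move=> s1 s2 dA wA Nn u01 c01 X0 X2 Hc X1 H1 X00 H0.
have /andP[u0 u1] := u01; have /andP[N0 _] := Nn.
have [part partV] := link_parts_label k dA wA.
have -> : (k + 5 = k.+3 + 2)%N by rewrite addnC [RHS]addnC.
apply: (partite_janson (part := part)) => //.
- by rewrite exprn_ge0 ?exprn_ile1 ?(ltW u0).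
- by move=> q; rewrite inE => /andP[/eqP].
- apply/card_gt0P; exists [set inord 0; inord 1]; rewrite inE cards2 !inE.
  by rewrite -!val_eqE /= !inordK.
move=> T T0.
have le := card_link_induced (erefl #|[set l in T | (l < 2)%N]|)
   (erefl #|[set l in T | (2 < l)%N]|).
have i2 : (#|[set l in T | (l < 2)%N]| <= 2)%N.
  apply: (@leq_trans #|[set (inord 0 : 'I_k.+3); inord 1]|); last first.
    by rewrite cards2; case: (_ == _).
  apply: subset_leq_card; apply/fintype.subsetP => l.
  rewrite !inE -!val_eqE /= !inordK // => /andP[_].
  by case: (nat_of_ord l) => [|[|]].
have jk : (#|[set l in T | (2 < l)%N]| <= k)%N.
  have : [set l in T | (2 < l)%N] \subset ~: (inord 0 |: [set inord 1; inord 2]).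
    apply/fintype.subsetP => l; rewrite !inE -!val_eqE /= !inordK // => /andP[_].
    by case: (nat_of_ord l) => [|[|[|]]].
  move=> /subset_leq_card/leq_trans; apply.
  rewrite cardsCs finset.setCK card_ord cardsU1 cards2 !inE -!val_eqE /= !inordK //=.
  by rewrite -addn3 addnK.
have pos := leq_trans (leq_ltn_trans (leq0n _) _) le.
have W := link_weight i2 jk (ler0n R s) u01 N0 c01 X2 Hc X1 H1 X00 H0.
apply: (le_trans (W _)); first by apply: leq_trans le; rewrite muln_gt0.
apply: ler_pM.
- by rewrite mulr_ge0 ?exprn_ge0.
- by rewrite exprn_ge0 ?(ltW u0).
- exact: prod_link_parts.
- by rewrite -exprM ler_wiXn2l ?(ltW u0).
Qed.

(** * Choice of parameters and union bound *)

(* The sets [A] have [2 s] vertices with [s] about [set_size * ln n / p]; the [r - 3] remaining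
   parts have at least [density * n] vertices each, and [n p^(r/2)] is at least
   [extension_degree * (ln n)^2].  Janson's exponent is [weight * s * ln n / 2 ^ (k + 5)]
   with [r = k + 3]. *)
Definition density (R : realType) (k : nat) : R := (4 * k%:R)^-1.
Definition weight (R : realType) (k : nat) : R := 6 * 2 ^+ (k + 5).
Definition set_size (R : realType) (k : nat) : R := weight R k / density R k ^+ k.
Definition extension_degree (R : realType) (k : nat) : R :=
  weight R k * (set_size R k + 1) / density R k.

Lemma density_bounds (R : realType) (k : nat) : (0 < k)%N -> 0 < density R k <= 1.
Proof.
move=> k0; have k1 : 1 <= k%:R :> R by rewrite ler1n.
have k4 : 0 < 4 * k%:R :> R by lra.
rewrite /density invr_gt0 k4 /= invf_le1 //; lra.
Qed.

Lemma weight_ge6 (R : realType) (k : nat) : 6 <= weight R k.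
Proof. by rewrite /weight ler_peMr // exprn_ege1 // ler1n. Qed.

Lemma set_sizeE (R : realType) (k : nat) : (0 < k)%N ->
  set_size R k * density R k ^+ k = weight R k.
Proof.
move=> /(density_bounds R)/andP[c0 _].
by rewrite divfK // expf_neq0 // gt_eqF.
Qed.

Lemma set_size_ge1 (R : realType) (k : nat) : (0 < k)%N -> 1 <= set_size R k.
Proof.
move=> k0; have /andP[c0 c1] := density_bounds R k0.
rewrite ler_pdivlMr ?exprn_gt0 // mul1r.
apply: (@le_trans _ _ 1); first by rewrite exprn_ile1 // ltW.
have := weight_ge6 R k; lra.
Qed.

Lemma extension_degreeE (R : realType) (k : nat) : (0 < k)%N ->
  extension_degree R k * density R k = weight R k * (set_size R k + 1).
Proof. by move=> /(density_bounds R)/andP[c0 _]; rewrite divfK // gt_eqF. Qed.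

(** A residue class has at least [4 * c * n - 1] vertices, where [c] is the density, and the degree
    condition forces [6 * s <= c * n]; removing [2 * s + 1] vertices leaves enough. *)
Lemma residue_size (R : realType) (n k s : nat) (u L : R) : (0 < k)%N ->
  0 < u <= 1 -> 1 <= L -> extension_degree R k * L ^+ 2 <= n%:R * u ^+ (k + 3) ->
  (0 < s)%N -> s%:R * u ^+ 2 <= (set_size R k + 1) * L ->
  density R k * n%:R <= (n %/ k - (2 * s).+1)%:R.
Proof.
move=> k0 /andP[u0 u1] L1 nu s0 su; set c := density R k.
have /andP[c0 c1] := density_bounds R k0.
have k1 : 1 <= k%:R :> R by rewrite ler1n.
have ck : c * (4 * k%:R) = 1 by rewrite mulVf // mulf_neq0 ?pnatr_eq0 // -lt0n.
have D6 := weight_ge6 R k; have K1 := set_size_ge1 R k0.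
have ZE := extension_degreeE R k0; rewrite -/c in c0 c1 ZE *.
have s1 : 1 <= s%:R :> R by rewrite ler1n.
have u2 : 0 < u ^+ 2 by rewrite exprn_gt0.
have nu2 : n%:R * u ^+ (k + 3) <= n%:R * u ^+ 2.
  by rewrite ler_wpM2l // ler_wiXn2l ?(ltW u0) // addnC.
have sn : 6 * s%:R <= c * n%:R.
  rewrite -(ler_pM2r u2).
  have : 6 * ((set_size R k + 1) * L) <= weight R k * (set_size R k + 1) * L ^+ 2.
    have : 1 * L <= L * L by rewrite ler_pM2r; lra.
    rewrite -expr2 mul1r => LL.
    have : (set_size R k + 1) * L <= (set_size R k + 1) * L ^+ 2.
      by rewrite ler_wpM2l //; lra.
    have : 6 * ((set_size R k + 1) * L ^+ 2) <= weight R k * ((set_size R k + 1) * L ^+ 2).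
      by rewrite ler_wpM2r // mulr_ge0 ?sqr_ge0 //; lra.
    rewrite mulrA; lra.
  have : c * (extension_degree R k * L ^+ 2) <= c * (n%:R * u ^+ 2).
    by rewrite ler_wpM2l ?(ltW c0) //; lra.
  rewrite [c * (_ * L ^+ 2)]mulrA [c * _]mulrC ZE -[6 * _ * _]mulrA -[c * _ * _]mulrA.
  lra.
have nk : n%:R * (4 * c) <= (n %/ k)%:R + 1.
  have : n%:R <= ((n %/ k)%:R + 1) * k%:R :> R.
    by rewrite -[1]/(1%:R) -natrD -natrM ler_nat addn1 ltnW // ltn_ceil.
  have c4 : 0 <= 4 * c by lra.
  move=> H; apply: (le_trans (ler_wpM2r c4 H)); rewrite -mulrA.
  have -> : k%:R * (4 * c) = c * (4 * k%:R) by ring.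
  by rewrite ck mulr1.
have subn_ge (a b : nat) : a%:R - b%:R <= (a - b)%:R :> R.
  have [ab|/ltnW ba] := leqP b a; first by rewrite natrB.
  by rewrite (eqP (_ : (a - b == 0)%N)) ?subn_eq0 // subr_le0 ler_nat.
apply: le_trans (subn_ge _ _); rewrite -natr1 natrM; lra.
Qed.

(** The two halves of [A] host pattern vertices 0 and 1. The lower bound on [s] handles subpatterns
    using both halves; the degree condition handles those using at most one, with the upper bound on
    [s] needed when neither is used. *)
Lemma bern_bad_pair (R : realType) (n k s : nat) (u L : R) (w : 'I_n)
    (A : {set 'I_n}) : (0 < k)%N ->
  0 < u <= 1 -> 1 <= L -> 1 <= n%:R * u ^+ (k + 5) ->
  extension_degree R k * L ^+ 2 <= n%:R * u ^+ (k + 3) ->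
  (0 < s)%N -> set_size R k * L <= s%:R * u ^+ 2 <= (set_size R k + 1) * L ->
  #|A| = (2 * s)%N ->
  \sum_(G : {set vpair n} | bad_pair k.+3 w A G) bern (u ^+ 2) G
  <= expR (- (6 * s%:R * L)).
Proof.
move=> k0 u01 L1 nu5 nu3 s0 /andP[sL su] cA.
have /andP[u0 u1] := u01.
have p01 : 0 <= u ^+ 2 <= 1 by rewrite exprn_ge0 ?exprn_ile1 ?(ltW u0).
have [wA|wA] := boolP (w \in A).
  rewrite big1 ?expR_ge0 // => G /andP[/forall_inP/(_ w wA)].
  by rewrite adj_irrefl.
have [|A1 A1A c1] := @subset_of_card _ A s; first by rewrite cA mul2n -addnn leq_addr.
have AE : A = A1 :|: A :\: A1 by rewrite -[LHS](finset.setID A A1) (finset.setIidPr A1A).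
have c2 : #|A :\: A1| = s by rewrite cardsDS // cA c1 mul2n -addnn addnK.
have dA : [disjoint A1 & A :\: A1].
  rewrite -finset.setI_eq0; apply/eqP/setP => x; rewrite !inE.
  by case: (x \in A1).
have -> : 6 * s%:R * L = (weight R k * s%:R * L) / 2 ^+ (k + 5).
  rewrite /weight; have : (2 ^+ (k + 5) : R) != 0 by rewrite expf_neq0.
  by move: (2 ^+ _) => z z0; field.
have c01 := density_bounds R k0; have /andP[cpos c1'] := c01.
have D6 := weight_ge6 R k; have K1 := set_size_ge1 R k0.
have KE := set_sizeE R k0; have ZE := extension_degreeE R k0.
have s1 : 1 <= s%:R :> R by rewrite ler1n.
set X := weight R k * s%:R * L.
have XE : X = s%:R * (weight R k * L) by rewrite /X; ring.
have deg3 : weight R k * (set_size R k + 1) * L ^+ 2 <= density R k * n%:R * u ^+ (k + 3).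
  rewrite -ZE mulrAC [leLHS]mulrC -mulrA.
  by apply: ler_wpM2l nu3; apply: ltW.
have LL : L <= L ^+ 2 by rewrite expr2 ler_peMl //; lra.
have DK1 : weight R k <= weight R k * (set_size R k + 1) by rewrite ler_peMr; lra.
have DKL : weight R k * L <= weight R k * (set_size R k + 1) * L ^+ 2.
  apply: ler_pM => //; lra.
have DL1 : 1 <= weight R k * L.
  have : 6 * 1 <= weight R k * L by apply: ler_pM.
  lra.
have one3 : 1 <= density R k * n%:R * u ^+ (k + 3).
  exact: le_trans DL1 (le_trans DKL deg3).
have mono : density R k * n%:R * u ^+ (k + 3) <= density R k * n%:R * u ^+ (k + 1).
  by rewrite ler_wpM2l ?mulr_ge0 ?(ltW cpos) // ler_wiXn2l ?(ltW u0) // leq_add2l.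
apply: le_trans (link_janson (w := w) (N := density R k * n%:R) (X := X)
    c1 c2 dA _ _ u01 c01 _ _ _ _ _ _ _).
- by apply: ler_sum_impl => G; [rewrite {1}AE; apply: link_avoids | apply: bern_ge0].
- by rewrite -AE.
- rewrite mulr_ge0 ?(ltW cpos) //=.
  exact: residue_size nu3 s0 su.
- by rewrite /X !mulr_gt0 //; lra.
- have -> : s%:R ^+ 2 * u ^+ 2 * density R k ^+ k
     = s%:R * (s%:R * u ^+ 2 * density R k ^+ k) by rewrite expr2 !mulrA.
  rewrite XE ler_wpM2l // -KE mulrAC.
  by rewrite ler_wpM2r ?exprn_ge0 ?(ltW cpos).
- by rewrite -mulrA ler_peMr ?(ltW cpos).
- by rewrite XE ler_wpM2l //; lra.
- by [].
- have u2 : 0 < u ^+ 2 by rewrite exprn_gt0.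
  rewrite -(ler_pM2r u2).
  have -> : density R k * n%:R * u ^+ (k + 1) * u ^+ 2 = density R k * n%:R * u ^+ (k + 3).
    by rewrite -mulrA -exprD -addnA.
  apply: le_trans deg3.
  have -> : X * u ^+ 2 = weight R k * L * (s%:R * u ^+ 2) by rewrite /X; ring.
  have -> : weight R k * (set_size R k + 1) * L ^+ 2
    = weight R k * L * ((set_size R k + 1) * L) by ring.
  by rewrite ler_wpM2l // mulr_ge0; lra.
- exact: le_trans mono.
Qed.

(** * Union bound over a vertex and a set of its neighbours *)

Lemma bin_le_exp (n a : nat) : ('C(n, a) <= n ^ a)%N.
Proof.
apply: (@leq_trans (n ^_ a)); first by rewrite -bin_ffact leq_pmulr ?fact_gt0.
rewrite ffact_prod; apply: (@leq_trans (\prod_(i < a) n)).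
  by apply: leq_prod => i _; apply: leq_subr.
by rewrite prod_nat_const card_ord.
Qed.

Lemma bern_not_dense (R : realType) (r n a : nat) (p e : R)
    (P : {set vpair n} -> bool) : 0 <= p <= 1 -> 0 <= e ->
  (forall w (A : {set 'I_n}), #|A| = a ->
     \sum_(G : {set vpair n} | bad_pair r w A G) bern p G <= e) ->
  (forall G, dense_triads r G a -> P G) ->
  \sum_(G : {set vpair n} | ~~ P G) bern p G <= n%:R ^+ a.+1 * e.
Proof.
move=> p01 e0 bad dense.
apply: (@le_trans _ _ (\sum_w \sum_(A : {set 'I_n} | #|A| == a)
    \sum_(G : {set vpair n} | bad_pair r w A G) bern p G)).
  under [leRHS]eq_bigr do rewrite (exchange_big_dep xpredT) //=.
  rewrite [leRHS]exchange_big /= [leLHS]big_mkcond /=; apply: ler_sum => G _.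
  have b0 := bern_ge0 G p01.
  case: ifP => [nP|_]; last by apply: sumr_ge0 => w _; apply: sumr_ge0.
  have [w [A /eqP Aa wA]] : exists w, exists2 A : {set 'I_n}, #|A| = a & bad_pair r w A G.
    by apply: dense_triadsPn => /dense; apply/negP.
  rewrite (bigD1 w) //= (bigD1 A) ?Aa //= -addrA lerDl.
  by rewrite addr_ge0 // ?sumr_ge0 // => w' _; apply: sumr_ge0.
apply: (@le_trans _ _ (\sum_(w : 'I_n) \sum_(A : {set 'I_n} | #|A| == a) e)).
  by apply: ler_sum => w _; apply: ler_sum => A /eqP; apply: bad.
rewrite !sumr_const card_ord -cardsE card_draws card_ord -mulrnA -[leLHS]mulr_natl.
rewrite ler_wpM2r // -natrX ler_nat expnS mulnC leq_mul2l bin_le_exp orbT //.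
Qed.

(** * Consequences of the threshold on the edge probability *)

(** With [x = L / m.+1], the right side is [expR (x / 2) ^+ 4 >= x ^+ 4 / 16], and two of the four
    factors [x] absorb the constants. *)
Lemma ln_growth (R : realType) (m : nat) (Z L : R) : 0 <= Z ->
  4 * m.+1%:R ^+ 2 * (1 + Z) <= L ->
  Z * L ^+ 2 <= expR (2 * (L / m.+1%:R)).
Proof.
move=> Z0; set M := m.+1%:R => ZL.
have M1 : 1 <= M :> R by rewrite ler1n.
set x := L / M; have LE : L = M * x by rewrite /x mulrC divfK // gt_eqF //; lra.
move: x LE ZL => x -> ZL.
have M0 : 0 < M by lra.
have {}ZL : 4 * M * (1 + Z) <= x.
  rewrite -(ler_pM2l M0); apply: le_trans ZL.
  by rewrite [leLHS](_ : _ = 4 * M ^+ 2 * (1 + Z)) //; ring.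
have x0 : 0 <= x by apply: le_trans ZL; rewrite !mulr_ge0 //; lra.
have -> : 2 * x = 4%:R * (x / 2) by field.
rewrite expRM_natl.
have ex : x / 2 <= expR (x / 2) by have := @expR_ge1Dx R (x / 2); lra.
apply: (@le_trans _ _ ((x / 2) ^+ 4)); last first.
  by rewrite lerXn2r ?nnegrE ?expR_ge0 //; lra.
have -> : (x / 2) ^+ 4 = x ^+ 2 / 16 * x ^+ 2 by field.
rewrite exprMn mulrA ler_wpM2r ?sqr_ge0 //.
have : (4 * M * (1 + Z)) ^+ 2 <= x ^+ 2.
  by rewrite lerXn2r ?nnegrE // !mulr_ge0 //; lra.
have : M ^+ 2 * Z <= M ^+ 2 * (1 + Z) ^+ 2.
  by rewrite ler_wpM2l ?sqr_ge0 //; nra.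
rewrite !exprMn; lra.
Qed.

(** With [r = k + 3] and [x = ln n / (r + 2)], the threshold says [Num.sqrt p >= expR (- x)].
    Exponent [k + 5 = r + 2] then cancels [n] exactly, while [k + 3] leaves [expR (2 * x)], a power
    of [n] that beats [(ln n) ^ 2]. *)
Lemma threshold_degrees (R : realType) (n k : nat) (p Z : R) : 0 <= Z ->
  (0 < n)%N -> 4 * (k + 4).+1%:R ^+ 2 * (1 + Z) <= ln n%:R :> R ->
  n%:R `^ (- 2 / (k.+3%:R + 2)) < p ->
  1 <= n%:R * Num.sqrt p ^+ (k + 5) /\
  Z * ln n%:R ^+ 2 <= n%:R * Num.sqrt p ^+ (k + 3).
Proof.
move=> Z0 n0 big np; set L := ln n%:R; set u := Num.sqrt p.
set x := L / (k + 4).+1%:R.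
have nE : n%:R = expR L by rewrite lnK // posrE ltr0n.
have M0 : (k + 4).+1%:R != 0 :> R by rewrite pnatr_eq0.
have ME : (k + 4).+1%:R = k.+3%:R + 2 :> R by rewrite -natrD (addnC k) (addnC k.+3).
have LE : L = (k + 4).+1%:R * x by rewrite /x mulrC divfK.
have vu : expR (- x) <= u.
  have -> : expR (- x) = Num.sqrt (expR (- x) ^+ 2).
    by rewrite sqrtr_sqr ger0_norm // expR_ge0.
  apply: ler_wsqrtr; apply: ltW; apply: le_lt_trans np.
  rewrite /powR pnatr_eq0 gtn_eqF // -ME -expRM_natl ler_expR -/L.
  by rewrite le_eqVlt; apply/orP; left; apply/eqP; rewrite /x; field.
have pow d : expR (L - d%:R * x) <= n%:R * u ^+ d.
  rewrite expRD nE ler_wpM2l ?expR_ge0 // -mulrN expRM_natl.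
  by rewrite lerXn2r ?nnegrE ?expR_ge0 // sqrtr_ge0.
split.
  by apply: le_trans (pow _); rewrite addnS {1}LE subrr expR0.
apply: le_trans (pow _); apply: (le_trans (ln_growth Z0 big)).
rewrite ler_expR -/L -/x {1}LE -addnS !natrD.
by rewrite le_eqVlt; apply/orP; left; apply/eqP; ring.
Qed.

Lemma gnp_num_orient (R : realType) (n k : nat) (p : R) : (0 < k)%N -> 0 < p <= 1 ->
  4 * (k + 4).+1%:R ^+ 2 * (1 + extension_degree R k) <= ln n%:R :> R ->
  n%:R `^ (- 2 / (k.+3%:R + 2)) < p ->
  \sum_(G : {set vpair n} | ~~ ((num_orient k.+3 G)%:R <=
     expR (152 * (set_size R k + 1) * (n%:R * ln n%:R ^+ 2) / p))) bern p G
  <= n%:R^-1.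
Proof.
move=> k0 /andP[p0 p1] big np; set L := ln n%:R.
have D6 := weight_ge6 R k; have K1 := set_size_ge1 R k0.
have Z0 : 0 <= extension_degree R k.
  have /andP[c0 _] := density_bounds R k0.
  by rewrite divr_ge0 ?(ltW c0) // mulr_ge0; lra.
have L1 : 1 <= L.
  apply: le_trans big; have : 1 <= (k + 4).+1%:R ^+ 2 :> R by rewrite exprn_ege1 // ler1n.
  move=> M1; have : 1 * 1 <= (k + 4).+1%:R ^+ 2 * (1 + extension_degree R k).
    by apply: ler_pM => //; lra.
  lra.
have n1 : (1 < n)%N.
  rewrite ltnNge; apply/negP => n1; have : L <= 0 by rewrite ln_le0 // lern1.
  lra.
have [nu5 nu3] := threshold_degrees Z0 (ltnW n1) big np.
set u := Num.sqrt p in nu5 nu3; have pE : p = u ^+ 2 by rewrite sqr_sqrtr // ltW.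
have u01 : 0 < u <= 1 by rewrite sqrtr_gt0 p0 /= -[1]sqrtr1 ler_wsqrtr.
have KLp : 0 <= set_size R k * L / p by rewrite divr_ge0 ?(ltW p0) // mulr_ge0; lra.
(* Rounding up adds at most 1, and [1 <= L / p]; hence the constant [set_size R k + 1]. *)
pose s := (Num.truncn (set_size R k * L / p)).+1.
have sb : set_size R k * L <= s%:R * u ^+ 2 <= (set_size R k + 1) * L.
  have /andP[lo hi] := truncn_itv KLp; rewrite -pE -ler_pdivrMr // (ltW hi) /=.
  rewrite -ler_pdivlMr // /s -natr1 mulrDl mulrDl mul1r lerD //.
  by rewrite ler_pdivlMr // mul1r; lra.
have s1 : 1 <= s%:R :> R by rewrite ler1n.
have Ls : L <= (2 * s)%:R.
  have /andP[lo _] := sb; rewrite natrM.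
  have : s%:R * u ^+ 2 <= s%:R * 1 by rewrite ler_wpM2l // -pE.
  have : 1 * L <= set_size R k * L by rewrite ler_wpM2r //; lra.
  lra.
have e0 : 0 <= expR (- (6 * s%:R * L)) by rewrite expR_ge0.
have p01 : 0 <= p <= 1 by rewrite (ltW p0).
apply: (le_trans (@bern_not_dense R k.+3 n (2 * s) p _ _ p01 e0 _ _)).
- by move=> w A cA; rewrite pE; apply: bern_bad_pair.
- move=> G dG.
  have La : 1 <= (ln n%:R : R) <= (2 * s)%:R by rewrite L1.
  apply: (le_trans (num_orient_le dG n1 _ La)); first by [].
  rewrite ler_expR -/L ler_pdivlMr // natrM.
  have /andP[_ hi] := sb; rewrite -pE in hi.
  have -> : 76 * (2 * s%:R * n%:R * L) * p = 152 * (n%:R * L) * (s%:R * p) by ring.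
  have -> : 152 * (set_size R k + 1) * (n%:R * L ^+ 2)
    = 152 * (n%:R * L) * ((set_size R k + 1) * L) by ring.
  by rewrite ler_wpM2l // !mulr_ge0 //; lra.
have nE : n%:R = expR L by rewrite lnK // posrE ltr0n ltnW.
(* The union bound has exponent [(2 * s + 1 - 6 * s) * L], at most [- L] because [1 <= s]. *)
rewrite nE -expRM_natl -expRD -expRN ler_expR -natr1 natrM.
have : 1 * L <= s%:R * L by rewrite ler_wpM2r //; lra.
lra.
Qed.

(** * Passage to the limit *)

Local Open Scope classical_set_scope.

Theorem theorem4p1 (R : realType) (r : nat) (hr : (4 <= r)%N) :
  exists2 C : R, 0 < C &
    forall p : nat -> R,
      (forall n, 0 <= p n <= 1) ->
      (\forall n \near \oo, n%:R `^ (- 2 / (r%:R + 2)) < p n) ->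
      gnp_prob (p n) (fun G : {set vpair n} =>
        (num_orient r G)%:R <= expR (C * (n%:R * ln n%:R ^+ 2) / p n))
        @[n --> \oo] --> (1 : R).
Proof.
have [k k0 rE] : exists2 k, (0 < k)%N & r = k.+3.
  by exists (r - 3)%N; [rewrite subn_gt0 | rewrite -addn3 subnK // ltnW].
rewrite {}rE; have K1 := set_size_ge1 R k0.
exists (152 * (set_size R k + 1)); first by lra.
move=> p p01 pbig; set B := 4 * (k + 4).+1%:R ^+ 2 * (1 + extension_degree R k) : R.
(* [harmonic n] is [1 / (n + 1)]; the factor 2 makes it dominate the failure probability [1 / n]. *)
apply: (@squeeze_cvgr _ _ _ _ (fun n => 1 - 2 * harmonic n) (fun=> 1)).
- near=> n.
  have n0 : (0 < n)%N by near: n; exact: nbhs_infty_gt.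
  have nB : B <= ln n%:R.
    have : ((Num.truncn (expR B)).+1 <= n)%N by near: n; exact: nbhs_infty_ge.
    move=> nN; rewrite -[B]expRK ler_ln ?posrE ?expR_gt0 ?ltr0n //.
    have /andP[_ /ltW/le_trans] := truncn_itv (expR_ge0 B); apply.
    by rewrite ler_nat.
  have np : n%:R `^ (- 2 / (k.+3%:R + 2)) < p n by near: n.
  have p0 : 0 < p n <= 1.
    by rewrite (le_lt_trans (powR_ge0 _ _) np); have /andP[] := p01 n.
  set P := fun G : {set vpair n} => _.
  have total : gnp_prob (p n) P + \sum_(G : {set vpair n} | ~~ P G) bern (p n) G = 1.
    by rewrite -(sum_bern (vpair n) (p n)) [RHS](bigID P).
  have bad := gnp_num_orient k0 p0 nB np.
  have bad0 : 0 <= \sum_(G : {set vpair n} | ~~ P G) bern (p n) G.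
    by apply: sumr_ge0 => G _; apply: bern_ge0.
  have inv : n%:R^-1 <= 2 * harmonic n :> R.
    rewrite /harmonic /= ler_pdivlMr ?ltr0n // mulrC ler_pdivrMr ?ltr0n //.
    by rewrite -natrM ler_nat; lia.
  apply/andP; split; first by move: bad; rewrite -/P; lra.
  lra.
- rewrite -[X in _ --> X]subr0 -[X in _ - X](mulr0 2).
  by apply: cvgB; [exact: cvg_cst | apply: cvgMr; exact: cvg_harmonic].
- exact: cvg_cst.
Unshelve. all: by end_near.
Qed.
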